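(* Let $P_1$ and $P_2$ be Markov chain kernels on a measurable space $(\mathcal{X},\mathcal{F})$, each having the probability measure $\pi(\cdot)$ as its unique stationary distribution. If $P_1$ and $P_2$ are both reversible with respect to $\pi(\cdot)$, and $P_1\succeq P_2$, and $P_2$ is variance bounding, then $P_1$ is variance bounding.
   Context: $P_1\succeq P_2$ ($P_1$ dominates $P_2$ off the diagonal) means that $P_1(x,A)\ge P_2(x,A)$ for all $x\in\mathcal{X}$ and $A\in\mathcal{F}$ with $x\notin A$. For a kernel $P$ with stationary distribution $\pi$, let $\{X_n\}_{n\ge 0}$ be the Markov chain with kernel $P$ started in stationarity ($X_0\sim\pi$). For measurable $h:\mathcal{X}\to\mathbf{R}$, $\operatorname{Var}_\pi(h)=\mathbf{E}[(h(X_0)-\mathbf{E}[h(X_0)])^2]$ is the stationary variance, and $\operatorname{Var}(h,P)=\lim_{n\to\infty}\frac1n\operatorname{Var}\left(\sum_{i=1}^n h(X_i)\right)$ is the asymptotic variance (for reversible $P$ and $h\in L^2(\pi)$ the limit always exists in $[0,\infty]$). $P$ is variance bounding if there is $K<\infty$ such that $\operatorname{Var}(h,P)\le K\operatorname{Var}_\pi(h)$ for all measurable $h:\mathcal{X}\to\mathbf{R}$ (the inequality is regarded as holding automatically when $\operatorname{Var}_\pi(h)=\infty$). $P$ is reversible with respect to $\pi$ if $\int_{A}\pi(dx)P(x,B)=\int_{B}\pi(dx)P(x,A)$ for all $A,B\in\mathcal{F}$. *)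

(* Defs.v *)
From HB Require Import structures.
From mathcomp Require Import all_boot all_order all_algebra.
From mathcomp Require Import all_classical all_reals all_analysis.
From mathcomp Require Import measurable_realfun.

Set Implicit Arguments.
Unset Strict Implicit.
Unset Printing Implicit Defensive.

Import Order.TTheory GRing.Theory Num.Theory.
Import numFieldNormedType.Exports.

Local Open Scope classical_set_scope.
Local Open Scope ring_scope.
Local Open Scope ereal_scope.

Section kernel_properties.
Context (d : measure_display) (T : measurableType d) (R : realType).
Implicit Types (P : R.-pker T ~> T) (pi : probability T R).

Definition stationary P pi : Prop :=
  forall A, measurable A -> \int[pi]_x P x A = pi A.

(* Uniqueness is as a probability measure on the sigma-algebra: Rocq measures
   are functions on all sets, whose values off it are irrelevant. *)
Definition unique_stationary P pi : Prop :=
  stationary P pi /\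
  forall mu : probability T R, stationary P mu ->
    forall A, measurable A -> mu A = pi A.

Definition reversible P pi : Prop :=
  forall A B, measurable A -> measurable B ->
    \int[pi]_(x in A) P x B = \int[pi]_(x in B) P x A.

Definition dominates_off_diagonal P1 P2 : Prop :=
  forall x A, measurable A -> ~ A x -> P2 x A <= P1 x A.

End kernel_properties.

Section path_law.
Context (d : measure_display) (T : measurableType d) (R : realType).
Variables (P : R.-pker T ~> T) (pi : probability T R).

Definition tuple_sing (x : T) : 1.-tuple T := [tuple x].

Lemma measurable_tuple_sing : measurable_fun [set: T] tuple_sing.
Proof.
apply/measurable_fun_tnthP => i.
rewrite (_ : _ \o _ = id); first exact: measurable_id.
by apply/funext => x /=; rewrite ord1.
Qed.

HB.instance Definition _ :=
  isMeasurableFun.Build _ _ _ _ tuple_sing measurable_tuple_sing.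

Definition tuple_rcons n (tx : n.-tuple T * T) : n.+1.-tuple T :=
  [tuple of rcons tx.1 tx.2].

Lemma measurable_tuple_rcons n :
  measurable_fun [set: n.-tuple T * T] (@tuple_rcons n).
Proof.
apply/measurable_fun_tnthP => i.
have [lt_in|ge_in] := ltnP i n.
  rewrite (_ : _ \o _ = (fun t => tnth t (Ordinal lt_in)) \o fst).
    exact: measurableT_comp (measurable_tnth _) measurable_fst.
  apply/funext => -[t x] /=.
  by rewrite !(tnth_nth x) /= nth_rcons size_tuple lt_in.
rewrite (_ : _ \o _ = snd); first exact: measurable_snd.
apply/funext => -[t x] /=.
have ein : i = n :> nat by apply/eqP; rewrite eqn_leq ge_in -ltnS ltn_ord.
by rewrite (tnth_nth x) /= nth_rcons size_tuple ein ltnn eqxx.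
Qed.

Section path_step.
Variables (n : nat) (mu : probability (n.+1.-tuple T) R).

Definition last_kernel (t : n.+1.-tuple T) : {measure set T -> \bar R} :=
  P (tnth t ord_max).

Let measurable_last_kernel U : measurable U ->
  measurable_fun [set: n.+1.-tuple T] (last_kernel ^~ U).
Proof.
move=> mU.
exact: measurableT_comp (measurable_kernel P U mU) (measurable_tnth ord_max).
Qed.

HB.instance Definition _ :=
  isKernel.Build _ _ _ _ _ last_kernel measurable_last_kernel.

Let last_kernel_setT t : last_kernel t [set: T] = 1.
Proof. exact: prob_kernel. Qed.

HB.instance Definition _ :=
  Kernel_isProbability.Build _ _ _ _ _ last_kernel last_kernel_setT.

(* The law of (X_0, ..., X_n, X_{n+1}) when (X_0, ..., X_n) has law mu and
   X_{n+1} is drawn from P (X_n, .). *)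
Definition path_step (A : set (n.+2.-tuple T)) : \bar R :=
  \int[mu]_t P (tnth t ord_max) [set x | A (tuple_rcons (t, x))].

Let sectionE (A : set (n.+2.-tuple T)) t :
  [set x | A (tuple_rcons (t, x))] = xsection (@tuple_rcons _ @^-1` A) t.
Proof. by apply/seteqP; split=> x /=; rewrite /xsection /= inE. Qed.

Let measurable_pre (A : set (n.+2.-tuple T)) : measurable A ->
  measurable (@tuple_rcons n.+1 @^-1` A).
Proof.
by move=> mA; rewrite -[X in measurable X]setTI; exact: measurable_tuple_rcons.
Qed.

Let measurable_section (A : set (n.+2.-tuple T)) t : measurable A ->
  measurable [set x | A (tuple_rcons (t, x))].
Proof.
by move=> mA; rewrite sectionE; apply: measurable_xsection;
   exact: measurable_pre.
Qed.

Let measurable_path_step (A : set (n.+2.-tuple T)) : measurable A ->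
  measurable_fun [set: n.+1.-tuple T]
    (fun t => P (tnth t ord_max) [set x | A (tuple_rcons (t, x))]).
Proof.
move=> mA; have mpA := measurable_pre mA.
rewrite (_ : (fun _ => _) =
    kfcomp last_kernel (EFin \o \1_(@tuple_rcons n.+1 @^-1` A))).
  apply: measurable_kfcomp => //.
    by apply/measurable_EFinP; exact: measurable_indic.
  by move=> tx; rewrite /= lee_fin.
by rewrite kfcompkindic//; apply/funext => t; rewrite sectionE.
Qed.

Let path_step0 : path_step set0 = 0.
Proof. by apply: integral0_eq => t _; rewrite (_ : mkset _ = set0). Qed.

Let path_step_ge0 A : 0 <= path_step A.
Proof. exact: integral_ge0. Qed.

Let path_step_sigma_additive : semi_sigma_additive path_step.
Proof.
move=> F mF tF mUF; rewrite [X in _ --> X](_ : _ =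
  \int[mu]_t (\sum_(k <oo)
     P (tnth t ord_max) [set x | F k (tuple_rcons (t, x))])); last first.
  apply: eq_integral => t _; apply/esym/cvg_lim => //.
  rewrite (_ : mkset _ = \bigcup_k [set x | F k (tuple_rcons (t, x))]) //.
  apply: measure_semi_sigma_additive.
  - by move=> k; exact: measurable_section.
  - apply/trivIsetP => i j _ _ ij; move/trivIsetP : tF => /(_ i j I I ij) Fij.
    apply/seteqP; split=> // x [Fi Fj].
    by have : set0 (tuple_rcons (t, x)) by rewrite -Fij.
  - exact: (measurable_section t mUF).
apply/cvg_closeP; split.
  by apply: is_cvg_nneseries => k _ _; exact: integral_ge0.
by rewrite closeE// integral_nneseries// => k; exact: measurable_path_step.
Qed.

HB.instance Definition _ := isMeasure.Build _ _ _ path_step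
  path_step0 path_step_ge0 path_step_sigma_additive.

Let path_step_setT : path_step [set: n.+2.-tuple T] = 1.
Proof.
rewrite -(probability_setT mu) -[RHS]mul1e -integral_cst//.
by apply: eq_integral => t _; exact: prob_kernel.
Qed.

HB.instance Definition _ :=
  Measure_isProbability.Build _ _ _ path_step path_step_setT.

End path_step.

(* The joint law of (X_0, ..., X_n) for the Markov chain with kernel P and
   X_0 ~ pi; the coordinate maps t |-> tnth t i are X_0, ..., X_n. *)
Fixpoint path_law n : probability (n.+1.-tuple T) R :=
  if n is m.+1 then path_step (path_law m) else distribution pi tuple_sing.

End path_law.

Section asymptotic_variance.
Context (d : measure_display) (T : measurableType d) (R : realType).
Variables (P : R.-pker T ~> T) (pi : probability T R).

(* h(X_1) + ... + h(X_n): lift ord0 skips the coordinate X_0. *)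
Definition path_sum (h : T -> R) n (t : n.+1.-tuple T) : R :=
  (\sum_(i < n) h (tnth t (lift ord0 i)))%R.

Definition scaled_variance (h : T -> R) n : \bar R :=
  (n%:R^-1)%:E * 'V_(path_law P pi n)[@path_sum h n].

Definition asymptotic_variance (h : T -> R) : \bar R :=
  limn (scaled_variance h).

(* [limn] has a default value on divergent sequences, so the existence of the
   limit is stated explicitly; it holds automatically when P is reversible.
   For measurable h, 'V_pi[h] < +oo iff h is in L^2(pi): if h is not
   integrable, then fine 'E_pi[h] = 0 and 'V_pi[h] = 'E_pi[h ^+ 2] = +oo. *)
Definition variance_bounding : Prop :=
  exists K : R, forall h : T -> R, measurable_fun [set: T] h ->
    'V_pi[h] < +oo ->
    cvgn (scaled_variance h) /\ asymptotic_variance h <= K%:E * 'V_pi[h].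

End asymptotic_variance.

(* Main.v *)
Require Import Defs.
From HB Require Import structures.
From mathcomp Require Import all_boot all_order all_algebra.
From mathcomp Require Import all_classical all_reals all_analysis.
From mathcomp Require Import measurable_realfun ring lra.
Set Implicit Arguments.
Unset Strict Implicit.
Unset Printing Implicit Defensive.
Import Order.TTheory GRing.Theory Num.Theory.
Import numFieldNormedType.Exports.
Local Open Scope classical_set_scope.
Local Open Scope ring_scope.

(* A reversible kernel P acts on bounded measurable functions as an operator
   that is symmetric for the covariance <f, g> under pi, and the variance of
   f(X_1) + ... + f(X_n) is a Toeplitz form W_n(f, f) in the numbers
   <f, P^k f>.  Variance bounding turns out to be equivalent to a Poincare
   inequality <f, f> <= C <f, (I - P) f>, and the Dirichlet form
     <f, (I - P) f> = 1/2 \int pi(dx) \int P(x, dy) (f(x) - f(y))^2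
   only sees the off-diagonal part of P, hence increases with it.

   Variance bounding => Poincare: I - P telescopes W_n, so that W_n >= 0 at
   f - a (f - P f), divided by n, leaves the inequality in the limit.
   Poincare => variance bounding: applied to S = f + P f + ... + P^(n-1) f it
   gives |S| <= 2 C |f|, hence W_n(f, f) <= 4 C n <f, f>; and W_n(f, f) / n is
   essentially the Cesaro mean of a sequence whose even and odd terms both
   converge.  Both the bound and the convergence pass to L^2 by density, the
   bound making the approximation uniform in n. *)

(** * Symmetric contractions and their Toeplitz forms *)

Section cesaro_even_odd.
Context (R : realType).

Lemma cvgn_even_odd (u : R^nat) (l : R) :
  u n.*2 @[n --> \oo] --> l -> u n.*2.+1 @[n --> \oo] --> l -> u @ \oo --> l.
Proof.
move=> ue uo; apply/cvgrPdist_le => e e0.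
move/cvgrPdist_le/(_ e e0) : ue => [N1 _ h1].
move/cvgrPdist_le/(_ e e0) : uo => [N2 _ h2].
exists (maxn N1 N2).*2 => // n /= hn.
have : (maxn N1 N2 <= n./2)%N by rewrite -[X in (X <= _)%N]doubleK half_leq.
rewrite geq_max => /andP[n1 n2].
rewrite -(odd_double_half n); case: (odd n) => /=.
  by rewrite add1n; exact: h2.
by rewrite add0n; exact: h1.
Qed.

(** With even limit [a] and odd limit [b], [u] is [(a + b) / 2 + (a - b) / 2 * (-1)^n] plus a null
    sequence [w]. The alternating part averages to 0 because its partial sums are always 0 or 1. *)
Lemma cesaro_even_odd (u : R^nat) :
  cvgn (fun n => u n.*2) -> cvgn (fun n => u n.*2.+1) ->
  cvgn (arithmetic_mean u).
Proof.
move=> /cvg_ex[/= a ua] /cvg_ex[/= b ub].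
pose v n : R := (-1) ^+ n.
pose w n := u n - (a + b) / 2 - (a - b) / 2 * v n.
have ve n : v n.*2 = 1 by rewrite /v -mul2n exprM sqrrN !expr1n.
have wl : w @ \oo --> 0.
  apply: cvgn_even_odd; rewrite /w.
    under eq_fun do rewrite ve mulr1.
    rewrite (_ : 0 = a - (a + b) / 2 - (a - b) / 2); last by field.
    do 2 (apply: cvgB; last exact: cvg_cst). by [].
  under eq_fun do rewrite [v _]exprS -/(v _) ve mulr1.
  rewrite (_ : 0 = b - (a + b) / 2 - (a - b) / 2 * -1); last by field.
  by do 2 (apply: cvgB; last exact: cvg_cst).
have vl : arithmetic_mean v @ \oo --> 0.
  have sv n : 0 <= series v n <= 1.
    rewrite /series/=; suff [->|->] : \sum_(0 <= k < n) v k = 0 \/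
        \sum_(0 <= k < n) v k = 1 by rewrite lexx ler01.
      elim: n => [|n IH]; first by left; rewrite big_geq.
      rewrite big_nat_recr//=; suff : \sum_(0 <= i < n) v i = (odd n)%:R.
        by move=> ->; rewrite /v -signr_odd; case: (odd n); [left|right];
          rewrite /= ?expr1 ?expr0 ?subrr ?add0r.
      elim: (n) => [|m IHm]; first by rewrite big_geq.
      rewrite big_nat_recr//= IHm /v -signr_odd.
      by case: (odd m); rewrite /= ?expr1 ?expr0 ?subrr ?add0r.
  apply: (@squeeze_cvgr _ _ _ _ (fun=> 0) (@harmonic R)).
  - near=> n; rewrite /arithmetic_mean /harmonic /=.
    have /andP[s0 s1] := sv n.+1.
    rewrite mulr_ge0 ?invr_ge0 ?ler0n//=.
    by rewrite -[leRHS]mulr1 ler_wpM2l ?invr_ge0 ?ler0n.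
  - exact: cvg_cst.
  - exact: cvg_harmonic.
apply/cvg_ex; exists (0 + (a + b) / 2 + (a - b) / 2 * 0).
rewrite (_ : arithmetic_mean u = fun n => arithmetic_mean w n + (a + b) / 2 +
    (a - b) / 2 * arithmetic_mean v n); last first.
  apply/funext => n; rewrite /arithmetic_mean/= /series/= /w.
  rewrite !big_split/= !sumrN sumr_const_nat subn0 -mulr_sumr.
  rewrite -(mulr_natl (_ / 2)).
  by field; rewrite nat1r pnatr_eq0.
apply: cvgD; last by apply: cvgM => //; exact: cvg_cst.
by apply: cvgD; [exact: cesaro|exact: cvg_cst].
Unshelve. all: by end_near.
Qed.

End cesaro_even_odd.

Section symmetric_contraction.
Context (R : realType) (V : lmodType R) (ip : V -> V -> R) (P : {linear V -> V}).
Hypothesis ipC : forall f g, ip f g = ip g f.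
Hypothesis ipDl : forall f g h, ip (f + g) h = ip f h + ip g h.
Hypothesis ipZl : forall a f g, ip (a *: f) g = a * ip f g.
Hypothesis ip_sym : forall f g, ip f (P g) = ip (P f) g.
Hypothesis ip_contr : forall f, `|ip f (P f)| <= ip f f.

Let ipDr f g h : ip h (f + g) = ip h f + ip h g.
Proof. by rewrite ipC ipDl !(ipC h). Qed.
Let ipZr a f g : ip f (a *: g) = a * ip f g.
Proof. by rewrite ipC ipZl (ipC f). Qed.
Let ipNl f g : ip (- f) g = - ip f g.
Proof. by rewrite -scaleN1r ipZl mulN1r. Qed.
Let ipNr f g : ip f (- g) = - ip f g.
Proof. by rewrite ipC ipNl ipC. Qed.
Let ip0l f : ip 0 f = 0.
Proof. by rewrite -(scale0r 0) ipZl mul0r. Qed.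
Let ip0r f : ip f 0 = 0.
Proof. by rewrite ipC ip0l. Qed.
Let ip_ge0 f : 0 <= ip f f.
Proof. exact: le_trans (normr_ge0 _) (ip_contr f). Qed.

Let ipE := (ipDl, ipDr, ipZl, ipZr, ipNl, ipNr).

Definition iterates_sum n (f : V) : V := \sum_(i < n) iter i P f.
Local Notation S := iterates_sum.

Lemma iterates_sumS n f : S n.+1 f = S n f + iter n P f.
Proof. by rewrite /S big_ord_recr. Qed.

Lemma iterates_sum_recl n f : S n.+1 f = f + P (S n f).
Proof. by rewrite /S big_ord_recl linear_sum. Qed.

(* [path_form n f f] is the variance of f(X_1) + ... + f(X_n) for the
   stationary chain when [ip] is the covariance under the stationary law. *)
Fixpoint path_form n (f g : V) : R :=
  if n is m.+1 then path_form m f g + ip f g + 2 * ip f (P (S m g)) else 0.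
Local Notation W := path_form.

Lemma ip_iter k f g : ip f (iter k P g) = ip (iter k P f) g.
Proof.
by elim: k f => // k IH f; rewrite iterS ip_sym IH -iterSr iterS.
Qed.

Lemma ip_iterD j k f g : ip (iter j P f) (iter k P g) = ip f (iter (j + k) P g).
Proof. by rewrite -ip_iter iterD. Qed.

Lemma ip_sum f n g : ip f (S n g) = \sum_(i < n) ip f (iter i P g).
Proof.
elim: n => [|n IH]; first by rewrite /S !big_ord0 ip0r.
by rewrite iterates_sumS ipDr IH big_ord_recr.
Qed.

Lemma ip_sum_sym f n g : ip f (S n g) = ip (S n f) g.
Proof.
by rewrite ip_sum ipC ip_sum; apply: eq_bigr => i _; rewrite ip_iter ipC.
Qed.

Lemma linear_iterates_sum n f : P (S n f) = S n (P f).
Proof.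
by rewrite /S linear_sum; apply: eq_bigr => i _; rewrite -iterS iterSr.
Qed.

(** [S n] is a polynomial in [P], hence symmetric for [ip] and commuting with [P]; this makes each
    increment of the form symmetric. *)
Lemma path_formC n f g : W n f g = W n g f.
Proof.
elim: n => //= n ->; rewrite (ipC f g); congr (_ + _ * _).
by rewrite ip_sym ip_sum_sym ipC -linear_iterates_sum.
Qed.

Lemma iterates_sumD n f g : S n (f + g) = S n f + S n g.
Proof.
elim: n => [|n IH]; first by rewrite /S !big_ord0 addr0.
by rewrite !iterates_sum_recl IH linearD addrACA.
Qed.

Lemma iterates_sumZ n a f : S n (a *: f) = a *: S n f.
Proof.
elim: n => [|n IH]; first by rewrite /S !big_ord0 scaler0.
by rewrite !iterates_sum_recl IH linearZ scalerDr.
Qed.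

Lemma path_formDr n f g h : W n f (g + h) = W n f g + W n f h.
Proof.
elim: n => /= [|n ->]; first by rewrite addr0.
rewrite iterates_sumD linearD !ipE; ring.
Qed.

Lemma path_formZr n a f g : W n f (a *: g) = a * W n f g.
Proof.
elim: n => /= [|n ->]; first by rewrite mulr0.
rewrite iterates_sumZ linearZ !ipE; ring.
Qed.

(** The hypothesis only bounds the quadratic form of [P]. Adding its upper bound at [f + P f] to its
    lower bound at [f - P f] cancels the odd terms and leaves [4 |P f|^2 <= 2 |f|^2 + 2 |P f|^2]. *)
Lemma ip_contraction f : ip (P f) (P f) <= ip f f.
Proof.
have /ler_normlP[] := ip_contr (f - P f); have /ler_normlP[] := ip_contr (f + P f).
rewrite !(linearD, linearN) /= !ipE (ip_sym f (P f)) (ipC (P f) f).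
lra.
Qed.

Lemma ip_iter_contraction k f : ip (iter k P f) (iter k P f) <= ip f f.
Proof. by elim: k => //= k; apply: le_trans; exact: ip_contraction. Qed.

Lemma ip_AMGM f g : 2 * `|ip f g| <= ip f f + ip g g.
Proof.
have := ip_ge0 (f - g); have := ip_ge0 (f + g); rewrite !ipE (ipC g f).
have [_|_] := ler0P (ip f g); lra.
Qed.

Lemma ip_iter_bound k f : `|ip f (iter k P f)| <= ip f f.
Proof. by have := ip_AMGM f (iter k P f); have := ip_iter_contraction k f; lra. Qed.

Lemma iterates_sum_sub n f : S n (f - P f) = f - iter n P f.
Proof.
elim: n => [|n IH]; first by rewrite /S big_ord0 subrr.
rewrite iterates_sum_recl IH linearB /= addrA subrK //.
Qed.

(* I - P telescopes the Toeplitz form. *)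
Lemma path_form_sub n f g :
  W n f (g - P g) = n%:R * (ip f g + ip f (P g)) - 2 * ip f (P (S n g)).
Proof.
elim: n => [|n IH]; first by rewrite /S big_ord0 linear0 ip0r mul0r mulr0 subrr.
rewrite /= IH iterates_sum_sub iterates_sumS !(linearD, linearN) /= !ipE.
rewrite -natr1; ring.
Qed.

Lemma path_form_quad n f : W n.+1 f f = W n f f + ip f f + 2 * ip f (P (S n f)).
Proof. by []. Qed.

(** Telescoping on both sides leaves [n (|f|^2 - |P f|^2)] and a boundary term of size at most
    [4 |f|^2]. The first is at most [2 n <f, (I - P) f>], because [|f - P f|^2 >= 0]. *)
Lemma path_form_sub_sub n f : W n (f - P f) (f - P f) <=
  2 * n%:R * (ip f f - ip f (P f)) + 4 * ip f f.
Proof.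
rewrite path_form_sub.
have -> : ip (f - P f) (P (S n f)) = ip f (P f) - ip f (iter n.+1 P f).
  rewrite ip_sym ip_sum_sym -linear_iterates_sum iterates_sum_sub.
  by rewrite linearB /= !ipE !(ipC f).
have := ip_iter_bound n.+1 f; rewrite ler_norml => /andP[b0 b1].
have := ip_iter_bound 1 f; rewrite ler_norml => /andP[b2 b3].
have := ip_ge0 (f - P f).
rewrite !ipE (ipC (P f) f) => h.
by have := ler_wpM2l (ler0n R n) h; rewrite mulr0 /= in b0 b1 b2 b3 *; lra.
Qed.

Lemma path_form_rescaled n s f : W n (f - s *: (f - P f)) (f - s *: (f - P f)) =
  W n f f - 2 * s * W n f (f - P f) + s ^+ 2 * W n (f - P f) (f - P f).
Proof.
set g := f - P f; have Wl h k : W n (h - s *: k) (h - s *: k) =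
    W n h h - 2 * s * W n h k + s ^+ 2 * W n k k.
  rewrite -scaleNr path_formDr path_formZr path_formC path_formDr path_formZr.
  rewrite (path_formC n (h + _) k) path_formDr path_formZr (path_formC n k h).
  ring.
exact: Wl.
Qed.

(* The form is tested on [f - s (f - P f)]: as n grows, the cross term and the
   last term, divided by n, tend to <f, (I + P) f> and at most 2 <f, (I - P) f>,
   so the nonnegativity of the form leaves a Poincare inequality. *)
Lemma poincare_of_variance_bound (K a s : R) f : a = (K + 1) / 4 ->
  (forall n g, 0 <= W n g g) -> 0 <= K ->
  n%:R^-1 * W n f f @[n --> \oo] --> s -> s <= K * ip f f ->
  ip f f <= (2 * a ^+ 2 + 2 * a) * (ip f f - ip f (P f)).
Proof.
move=> aE W0 K0 cs sK.
have a0 : 0 <= a by lra.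
pose x n := n%:R^-1 * W n f f.
pose N := ip f f; pose E := N - ip f (P f).
have cx : x n.+1 @[n --> \oo] --> s by rewrite (cvg_shiftS x).
have cx2 : x n.+2 @[n --> \oo] --> s by rewrite (cvg_shiftS (fun n => x n.+1)).
have ch := @cvg_harmonic R.
(* [u n] bounds from above the form at [f - a (f - P f)] divided by [n.+1], which is the inverse of
   [harmonic n]. The boundary term [2 <f, P S f>] is written as an increment of [W], so that after
   division it tends to [s - s = 0]. *)
pose u n := x n.+1 - 2 * a * ((N + ip f (P f)) -
    ((1 + harmonic n) * x n.+2 - x n.+1 - harmonic n * N)) +
    a ^+ 2 * (2 * E + 4 * (harmonic n * N)).
have u0 n : 0 <= u n.
  have n0 : (n.+1%:R : R) != 0 by rewrite pnatr_eq0.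
  have n1 : (n.+2%:R : R) != 0 by rewrite pnatr_eq0.
  have := W0 n.+1 (f - a *: (f - P f)).
  rewrite path_form_rescaled path_form_sub.
  have -> : 2 * ip f (P (S n.+1 f)) = W n.+2 f f - W n.+1 f f - ip f f.
    by rewrite path_form_quad; ring.
  move=> W1; have W2 := path_form_sub_sub n.+1 f.
  have {W1 W2} : 0 <= W n.+1 f f -
      2 * a * (n.+1%:R * (ip f f + ip f (P f)) -
      (W n.+2 f f - W n.+1 f f - ip f f)) +
      a ^+ 2 * (2 * n.+1%:R * (ip f f - ip f (P f)) + 4 * ip f f).
    apply: (le_trans W1); rewrite lerD2l; apply: ler_wpM2l W2.
    exact: exprn_ge0.
  have i0 : 0 <= (n.+1%:R^-1 : R) by rewrite invr_ge0 ler0n.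
  move=> /(mulr_ge0 i0); congr (_ <= _).
  rewrite /u /x /harmonic /= -/N /E.
  have e : (n.+2%:R : R) = n.+1%:R + 1 by rewrite -natr1.
  rewrite e in n1 *.
  by rewrite -/N; field; rewrite nat1r n0 n1.
have cu : u @ \oo --> s - 2 * a * ((N + ip f (P f)) -
    ((1 + 0) * s - s - 0 * N)) + a ^+ 2 * (2 * E + 4 * (0 * N)).
  have chN : harmonic n * N @[n --> \oo] --> 0 * N.
    by apply: cvgM => //; exact: cvg_cst.
  apply: cvgD; first apply: cvgB => //.
    apply: cvgM; first exact: cvg_cst.
    apply: cvgB; first exact: cvg_cst.
    apply: cvgB => //; apply: cvgB => //; apply: cvgM => //.
    by apply: cvgD => //; exact: cvg_cst.
  apply: cvgM; first exact: cvg_cst.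
  apply: cvgD; first exact: cvg_cst.
  by apply: cvgM => //; exact: cvg_cst.
have : 0 <= s - 2 * a * ((N + ip f (P f)) -
    ((1 + 0) * s - s - 0 * N)) + a ^+ 2 * (2 * E + 4 * (0 * N)).
  rewrite -(cvg_lim _ cu)//; apply: limr_ge; first exact: cvgP cu.
  by apply: nearW => n; exact: u0.
rewrite /E -/N in sK *.
(* The limit reads [0 <= s - 2 a (2 N - E) + 2 a^2 E]. Since [s <= K N], this value of [a] makes the
   coefficient of [N] equal to [K - 4 a = -1]. *)
have : K = 4 * a - 1 by rewrite aE; field.
nra.
Qed.

(** * Consequences of a Poincare inequality *)

Section poincare.
Variable C : R.
Hypothesis C_gt0 : 0 < C.
Hypothesis poincare : forall f, ip f f <= C * (ip f f - ip f (P f)).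

(** As [I - P] telescopes [S n f], the Poincare inequality at [u = S n f] reads
    [|u|^2 <= C <u, f - v>] with [v = P^n f]. Expanding [|u - C (f - v)|^2 >= 0] then gives
    [|u| <= C |f - v|], and [|f - v| <= 2 |f|] since [P] is a contraction. *)
Lemma iterates_sum_bound n f : ip (S n f) (S n f) <= 4 * C ^+ 2 * ip f f.
Proof.
have := poincare (S n f).
have -> : ip (S n f) (S n f) - ip (S n f) (P (S n f)) =
    ip (S n f) (f - iter n P f).
  by rewrite -iterates_sum_sub linear_iterates_sum -ipNr -ipDr -scaleN1r
    -iterates_sumZ -iterates_sumD scaleN1r.
have := ip_ge0 (S n f - C *: (f - iter n P f)).
have := ip_ge0 (f + iter n P f); have := ip_iter_contraction n f.
move: (S n f) (iter n P f) => u v.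
rewrite !ipE (ipC f u) (ipC v u) (ipC v f).
have C2 : 0 <= C ^+ 2 by exact: exprn_ge0 (ltW _).
move=> hv hs hm hp.
have h1 : 0 <= C ^+ 2 * (ip f f - ip v v) by apply: mulr_ge0 => //; lra.
have h2 : 0 <= C ^+ 2 * (ip f f + ip f v + (ip f v + ip v v)).
  exact: mulr_ge0.
nra.
Qed.

Lemma ip_iterates_sum_bound n f : `|ip f (S n f)| <= 2 * C * ip f f.
Proof.
(* The weight [2 C] makes both squares at most [4 C^2 |f|^2]. *)
have := ip_AMGM ((2 * C) *: f) (S n f); have := iterates_sum_bound n f.
have C2 : 0 < 2 * C by rewrite mulr_gt0.
rewrite !ipE normrM (gtr0_norm C2) => h1 h2.
rewrite -(ler_pM2l C2) -(ler_pM2l (ltr0Sn R 1)) (le_trans h2)//.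
by rewrite (le_trans (lerD (lexx _) h1))//; lra.
Qed.

(** This exhibits [W n f f / n] as twice a Cesaro mean, up to a constant. *)
Lemma path_form_cesaro n f :
  W n f f = 2 * (\sum_(0 <= m < n) ip f (S m.+1 f)) - n%:R * ip f f.
Proof.
elim: n => [|n IH]; first by rewrite big_geq //=; ring.
rewrite big_nat_recr//= IH [in RHS]iterates_sum_recl !ipE -natr1.
ring.
Qed.

Lemma path_form_le n f : W n f f <= n%:R * (4 * C * ip f f).
Proof.
elim: n => [|n IH]; first by rewrite /= mul0r.
rewrite path_form_quad -natr1.
have := ip_iterates_sum_bound n.+1 f; rewrite iterates_sum_recl !ipE ler_norml.
have := ip_ge0 f.
by move=> ? /andP[? ?]; lra.
Qed.

(** The terms [<f, P^k f>] may oscillate with the parity of [k], so even and odd indices are treated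
    apart. [<f, S_2n f>] increases, as each step adds [|g|^2 + <g, P g> >= 0] with [g = P^n f], and
    it is bounded by the Poincare inequality. [<f, P^2n f> = |P^n f|^2] decreases. The odd sums are
    the sums of the two. *)
Lemma cvgn_path_form f : cvgn (fun n => n%:R^-1 * W n f f).
Proof.
pose u m := ip f (S m.+1 f).
suff /cvg_ex[/= l ul] : cvgn (arithmetic_mean u).
  apply/cvg_ex; exists (2 * l - ip f f).
  rewrite -cvg_shiftS /=.
  rewrite (_ : (fun n => _) = fun n => 2 * arithmetic_mean u n - ip f f).
    by apply: cvgB; [apply: cvgM => //|]; exact: cvg_cst.
  apply/funext => n; rewrite -[X in _ * X = _]/(W n.+1 f f) path_form_cesaro.
  rewrite /arithmetic_mean /series/= -/(u _).
  by field; rewrite nat1r pnatr_eq0.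
have ipS2 n : ip f (iter n.*2 P f) = ip (iter n P f) (iter n P f).
  by rewrite -addnn ip_iterD.
have /cvg_ex[/= a ca] : cvgn (fun n => ip f (S n.*2 f)).
  apply: nondecreasing_is_cvgn.
    apply/nondecreasing_seqP => n.
    rewrite doubleS !iterates_sumS !ipE -addrA lerDl ipS2.
    rewrite iterS (_ : ip f (P _) = ip (iter n P f) (P (iter n P f))).
      by have := ip_contr (iter n P f); rewrite ler_norml => /andP[? _]; lra.
    by rewrite -!iterS ip_iterD addnS -addnn.
  exists (2 * C * ip f f) => _ [n _ <-].
  exact: le_trans (ler_norm _) (ip_iterates_sum_bound _ _).
have /cvg_ex[/= b cb] : cvgn (fun n => ip f (iter n.*2 P f)).
  apply: nonincreasing_is_cvgn.
    by apply/nonincreasing_seqP => n; rewrite !ipS2 /=; exact: ip_contraction.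
  by exists 0 => _ [n _ <-]; rewrite ipS2.
apply: cesaro_even_odd; apply/cvg_ex.
  exists (a + b); rewrite /u; under eq_fun do rewrite iterates_sumS ipDr.
  exact: cvgD.
exists a; rewrite /u; under eq_fun do rewrite -doubleS.
by move: ca; rewrite -cvg_shiftS.
Qed.

End poincare.

End symmetric_contraction.

(** * Bounded measurable functions and kernels *)

Section bounded_measurable.
Context (R : realType).

Definition bmeas d (S : measurableType d) (f : S -> R) : Prop :=
  measurable_fun [set: S] f /\ exists M, forall x, `|f x| <= M.

Section bmeas_closure.
Context d (S : measurableType d).
Implicit Types f g : S -> R.

Lemma bmeas_cst c : bmeas (fun _ : S => c).
Proof. by split; [exact: measurable_cst|exists `|c|]. Qed.

Lemma bmeasD f g : bmeas f -> bmeas g -> bmeas (fun x => f x + g x).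
Proof.
move=> [mf [M fM]] [mg [N gN]]; split; first exact: measurable_funD.
by exists (M + N) => x; rewrite (le_trans (ler_normD _ _))// lerD.
Qed.

Lemma bmeasM f g : bmeas f -> bmeas g -> bmeas (fun x => f x * g x).
Proof.
move=> [mf [M fM]] [mg [N gN]]; split; first exact: measurable_funM.
by exists (M * N) => x; rewrite normrM ler_pM.
Qed.

Lemma bmeasZ c f : bmeas f -> bmeas (fun x => c * f x).
Proof. by apply: bmeasM; exact: bmeas_cst. Qed.

Lemma bmeasN f : bmeas f -> bmeas (fun x => - f x).
Proof.
by move=> /(bmeasZ (-1)); congr bmeas; apply/funext => x; rewrite mulN1r.
Qed.

Lemma bmeasB f g : bmeas f -> bmeas g -> bmeas (fun x => f x - g x).
Proof. by move=> bf /bmeasN; exact: bmeasD. Qed.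

Lemma bmeas_sqr f : bmeas f -> bmeas (fun x => f x ^+ 2).
Proof. by move=> bf; exact: bmeasM. Qed.

Lemma bmeas_indic (A : set S) : measurable A -> bmeas (\1_A : S -> R).
Proof.
move=> mA; split; first exact: measurable_indic.
by exists 1 => x; rewrite indicE; case: (_ \in _); rewrite ?normr1 ?normr0.
Qed.

Lemma bmeas_sum (I : Type) (r : seq I) (F : I -> S -> R) :
  (forall i, bmeas (F i)) -> bmeas (fun x => \sum_(i <- r) F i x).
Proof.
move=> bF; elim: r => [|i r IH].
  by under eq_fun do rewrite big_nil; exact: bmeas_cst.
by under eq_fun do rewrite big_cons; exact: bmeasD.
Qed.

Lemma bmeas_comp d' (S' : measurableType d') f (u : S' -> S) :
  measurable_fun setT u -> bmeas f -> bmeas (f \o u).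
Proof.
move=> mu [mf [M fM]]; split; first exact: measurableT_comp.
by exists M => x /=.
Qed.

Let sum_floor (y : R) m : 0 <= y ->
  let s := \sum_(i < m) (if i.+1%:R <= y then 1 else 0) in
  (m%:R <= y -> s = m%:R) /\ (y <= m%:R -> y - 1 <= s /\ s <= y).
Proof.
move=> y0; elim: m => [|m [IH1 IH2]]; rewrite ?big_ord0 ?big_ord_recr/=.
  by split=> // y1; split; lra.
have mS : m.+1%:R = m%:R + 1 :> R by rewrite -natr1.
rewrite mS; case: ifPn => [ym|]; last rewrite -ltNge => ym.
  by have -> := IH1 ltac:(lra); split=> // y1; split; lra.
split=> [|y1]; first lra.
have [ym'|ym'] := leP y m%:R; first by have [] := IH2 ym'; split; lra.
by have -> := IH1 (ltW ym'); split; lra.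
Qed.

(* [f] is within 1/N of the average of the indicators of [f >= k/N]. *)
Let bmeas_unit_ind (Phi : (S -> R) -> Prop) :
  (forall A, measurable A -> Phi \1_A) ->
  (forall f g, bmeas f -> bmeas g -> Phi f -> Phi g -> Phi (fun x => f x + g x)) ->
  (forall c f, bmeas f -> Phi f -> Phi (fun x => c * f x)) ->
  (forall f, bmeas f -> (forall e, 0 < e ->
     exists g, [/\ bmeas g, Phi g & forall x, `|f x - g x| <= e]) -> Phi f) ->
  forall f, bmeas f -> (forall x, 0 <= f x <= 1) -> Phi f.
Proof.
move=> PA PD PZ PU f bf f01; apply: PU => // e e0.
have [N Ne] : exists N : nat, e^-1 <= N.+1%:R.
  exists (Num.bound e^-1); rewrite (le_trans (ltW (archi_boundP _)))//.
    by rewrite invr_ge0 ltW.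
  by rewrite ler_nat.
pose A k := [set x | k%:R <= N.+1%:R * f x].
have mA k : measurable (A k).
  have : measurable_fun [set: S] (fun x => k%:R <= N.+1%:R * f x).
    by apply: measurable_fun_ler => //; apply: measurable_funM => //; case: bf.
  by move=> /(_ measurableT [set true] ltac:(by [])); rewrite setTI.
have bs m : bmeas (fun x => \sum_(i < m) \1_(A i.+1) x).
  by apply: bmeas_sum => i; exact: bmeas_indic.
exists (fun x => N.+1%:R^-1 * \sum_(i < N.+1) \1_(A i.+1) x); split.
- exact/bmeasZ.
- apply: PZ => //; elim: N.+1 => [|m IH].
    under eq_fun do rewrite big_ord0.
    by have := PA set0 measurable0; rewrite indic0.
  under eq_fun do rewrite big_ord_recr/=.
  apply: (PD _ \1_(A m.+1)) => //; first exact: bs.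
    exact: bmeas_indic.
  exact: PA.
- move=> x; have N0 : 0 < N.+1%:R :> R by rewrite ltr0n.
  have /andP[f0 f1] := f01 x.
  rewrite -(ler_pM2l N0) -{1}(gtr0_norm N0) -normrM mulrBr mulVKf ?gt_eqF//.
  apply: (@le_trans _ _ 1); last by rewrite -(ler_pdivrMr _ _ e0) mul1r.
  have y0 : 0 <= N.+1%:R * f x by rewrite mulr_ge0 ?ler0n.
  have yN : N.+1%:R * f x <= N.+1%:R by rewrite ler_piMr ?ler0n.
  have [_ /(_ yN)[h1 h2]] := sum_floor N.+1 y0.
  rewrite (eq_bigr (fun i : 'I_N.+1 =>
      if i.+1%:R <= N.+1%:R * f x then 1 else 0)); last first.
    move=> i _; rewrite indicE; case: ifPn => h; first by rewrite mem_set.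
    by rewrite memNset//; exact/negP.
  by rewrite ler_norml; lra.
Qed.

(** An affine change of scale reduces to values in [[0, 1]]: [c] is at least twice a bound of [|f|],
    and the added 1 keeps it positive. *)
Lemma bmeas_ind (Phi : (S -> R) -> Prop) :
  (forall A, measurable A -> Phi \1_A) ->
  (forall f g, bmeas f -> bmeas g -> Phi f -> Phi g -> Phi (fun x => f x + g x)) ->
  (forall c f, bmeas f -> Phi f -> Phi (fun x => c * f x)) ->
  (forall f, bmeas f -> (forall e, 0 < e ->
     exists g, [/\ bmeas g, Phi g & forall x, `|f x - g x| <= e]) -> Phi f) ->
  forall f, bmeas f -> Phi f.
Proof.
move=> PA PD PZ PU f bf; have [_ [M fM]] := bf.
pose c := 2 * (`|M| + 1); have c0 : 0 < c by rewrite mulr_gt0// ltr_wpDl.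
pose g x := c^-1 * (f x + c / 2).
have bg : bmeas g by apply: bmeasZ; apply: bmeasD => //; exact: bmeas_cst.
rewrite (_ : f = fun x => c * g x + - (c / 2) * \1_[set: S] x); last first.
  by apply/funext => x; rewrite indicT /g mulr1 mulVKf ?gt_eqF// addrK.
have b1 : bmeas (\1_[set: S] : S -> R) by apply: bmeas_indic.
apply: (PD); [exact: bmeasZ|exact: bmeasZ| |by apply: (PZ) => //; exact: (PA)].
apply: (PZ) => //; apply: (bmeas_unit_ind PA PD PZ PU) => // x.
rewrite /g ler_pdivlMl// mulr0.
rewrite ler_pdivrMl// mulr1; have := fM x; rewrite ler_norml.
have := ler_norm M; rewrite /c; move: `|M| => a aM /andP[? ?].
by apply/andP; split; lra.
Qed.

End bmeas_closure.
End bounded_measurable.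

Ltac bmeas_tac := repeat first
  [ assumption | apply: bmeas_cst | apply: bmeas_sqr | apply: bmeasB
  | apply: bmeasD | apply: bmeasM | apply: bmeasN ].

Section mean.
Context (R : realType) d (S : measurableType d).
(** A plain measure with total mass one as a hypothesis, so that the lemmas apply to each [P x] as
    well as to [pi] and to path laws. *)
Variable mu : {measure set S -> \bar R}.
Hypothesis mu1 : mu [set: S] = 1%E.
Implicit Types f g : S -> R.

Lemma bmeas_integrable f : bmeas f -> mu.-integrable [set: S] (EFin \o f).
Proof.
move=> [mf [M fM]]; apply: measurable_bounded_integrable => //.
  by rewrite mu1 ltry.
exists M; split; rewrite ?num_real// => N MN x _ /=.
exact: le_trans (fM x) (ltW MN).
Qed.

Lemma EFin_mean f : bmeas f -> (\int[mu]_x f x)%:E = (\int[mu]_x (f x)%:E)%E.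
Proof.
move=> bf; rewrite fineK// integrable_fin_num//; exact: bmeas_integrable.
Qed.

Lemma meanD f g : bmeas f -> bmeas g ->
  \int[mu]_x (f x + g x) = \int[mu]_x f x + \int[mu]_x g x.
Proof. by move=> bf bg; rewrite RintegralD//; exact: bmeas_integrable. Qed.

Lemma meanZ c f : bmeas f -> \int[mu]_x (c * f x) = c * \int[mu]_x f x.
Proof. by move=> bf; rewrite RintegralZl//; exact: bmeas_integrable. Qed.

Lemma mean_cst c : \int[mu]_x c = c.
Proof. by rewrite Rintegral_cst// [fine _](_ : _ = 1) ?mulr1// mu1. Qed.

Lemma le_mean f g : bmeas f -> bmeas g -> (forall x, f x <= g x) ->
  \int[mu]_x f x <= \int[mu]_x g x.
Proof. by move=> bf bg fg; apply: le_Rintegral => //; exact: bmeas_integrable. Qed.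

Lemma mean_bound f M : measurable_fun [set: S] f -> (forall x, `|f x| <= M) ->
  `|\int[mu]_x f x| <= M.
Proof.
move=> mf fM; have bf : bmeas f by split => //; exists M.
rewrite ler_norml -{1}(mean_cst (- M)) -{2}(mean_cst M).
apply/andP; split; apply: le_mean => //; try exact: bmeas_cst.
  by move=> x; have := fM x; rewrite ler_norml => /andP[].
by move=> x; exact: le_trans (ler_norm _) (fM x).
Qed.

Lemma mean_indic A : measurable A -> \int[mu]_x (\1_A x) = fine (mu A).
Proof. by move=> mA; rewrite /Rintegral integral_indic// setIT. Qed.

End mean.

(** Identities between means are proved by taking for [L] the difference of their two sides, so that
    only indicators remain to be checked. The bound by [c * M] makes the zero set of [L] closed
    under uniform limits. *)
Lemma bmeas_functional_eq0 (R : realType) d (S : measurableType d)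
    (L : (S -> R) -> R) (c : R) :
  (forall f g, bmeas f -> bmeas g -> L (fun x => f x + g x) = L f + L g) ->
  (forall a f, bmeas f -> L (fun x => a * f x) = a * L f) ->
  (forall (f : S -> R) (M : R), measurable_fun [set: S] f ->
     (forall x, `|f x| <= M) -> `|L f| <= c * M) ->
  (forall A, measurable A -> L \1_A = 0) ->
  forall f, bmeas f -> L f = 0.
Proof.
move=> LD LZ Lc LA; apply: bmeas_ind => //.
- by move=> f g bf bg f0 g0; rewrite LD// f0 g0 addr0.
- by move=> a f bf f0; rewrite LZ// f0 mulr0.
move=> f bf fg; apply/eqP; rewrite -normr_le0; apply/ler_addgt0Pl => e e0.
rewrite addr0; have c0 : 0 < `|c| + 1 by rewrite ltr_wpDl.
have [g [bg g0 fge]] := fg _ (divr_gt0 e0 c0).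
have bN : bmeas (fun x => -1 * g x) by exact: bmeasZ.
have -> : L f = L (fun x => f x + -1 * g x).
  by rewrite LD// LZ// g0 mulr0 addr0.
have fge' x : `|f x + -1 * g x| <= e / (`|c| + 1) by rewrite mulN1r.
apply: (le_trans (Lc _ (e / (`|c| + 1)) _ fge')); first by case: (bmeasD bf bN).
rewrite mulrA ler_pdivrMr// mulrC ler_pM2l//.
by rewrite (le_trans (ler_norm _))// lerDl.
Qed.

Section kernel_mean.
Context (R : realType) d d' (X : measurableType d) (Y : measurableType d').
Variable P : R.-pker X ~> Y.

Lemma bmeas_kernel_mean (F : X * Y -> R) : bmeas F ->
  bmeas (fun x => \int[P x]_y F (x, y)).
Proof.
move=> bF; have [mF [M FM]] := bF.
have bx x : bmeas (fun y => F (x, y)).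
  by apply: (bmeas_comp _ bF); exact: measurable_pair1.
split; last first.
  exists M => x; apply: mean_bound => //; first exact: prob_kernel.
  by case: (bx x).
(* Measurability of a kernel integral in its parameter is applied to a nonnegative integrand, hence
   the shift by the bound [M]. *)
rewrite (_ : (fun x => _) =
    fun x => fine (\int[P x]_y (F (x, y) + M)%:E)%E - M); last first.
  apply/funext => x; rewrite -[X in _ = X - _]/(\int[P x]_y (F (x, y) + M)).
  rewrite meanD ?mean_cst ?addrK//; try exact: prob_kernel.
  exact: bmeas_cst.
apply: measurable_funB => //; apply: measurableT_comp; first exact: fine_measurable.
apply: (@measurable_fun_integral_finite_kernel _ _ _ _ _ (fun z => (F z + M)%:E)).
  move=> z; have := FM z; rewrite lee_fin ler_norml => /andP[? _]; lra.
by apply/measurable_EFinP; apply: measurable_funD.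
Qed.

Definition kernel_op (f : Y -> R) (x : X) := \int[P x]_y f y.

Lemma bmeas_kernel_op f : bmeas f -> bmeas (kernel_op f).
Proof.
move=> bf; apply: (@bmeas_kernel_mean (f \o snd)).
by apply: bmeas_comp bf; exact: measurable_snd.
Qed.

Lemma kernel_opD f g : bmeas f -> bmeas g ->
  kernel_op (fun y => f y + g y) = (fun x => kernel_op f x + kernel_op g x).
Proof.
by move=> bf bg; apply/funext => x; rewrite /kernel_op meanD//; exact: prob_kernel.
Qed.

Lemma kernel_opZ c f : bmeas f ->
  kernel_op (fun y => c * f y) = (fun x => c * kernel_op f x).
Proof.
by move=> bf; apply/funext => x; rewrite /kernel_op meanZ//; exact: prob_kernel.
Qed.

Lemma kernel_op_bound (f : Y -> R) (M : R) : measurable_fun [set: Y] f ->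
  (forall x, `|f x| <= M) -> forall x, `|kernel_op f x| <= M.
Proof.
by move=> mf fM x; apply: mean_bound => //; exact: prob_kernel.
Qed.

End kernel_mean.

(** * Stationarity and reversibility on bounded functions *)

Section reversible_kernel.
Context (R : realType) d (T : measurableType d).
Variables (P : R.-pker T ~> T) (pi : probability T R).
Let pi1 : pi [set: T] = 1%E := probability_setT pi.

Lemma mean_kernel_op (f : T -> R) : stationary P pi -> bmeas f ->
  \int[pi]_x kernel_op P f x = \int[pi]_x f x.
Proof.
move=> sP; pose L f := \int[pi]_x kernel_op P f x - \int[pi]_x f x.
move=> bf; apply/eqP; rewrite -subr_eq0; apply/eqP; move: f bf.
apply: (@bmeas_functional_eq0 _ _ _ L 2).
- move=> f g bf bg; rewrite /L kernel_opD// !meanD//; try exact: bmeas_kernel_op.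
  lra.
- by move=> a f bf; rewrite /L kernel_opZ// !meanZ//; [lra|exact: bmeas_kernel_op].
- move=> f M mf fM; rewrite (le_trans (ler_normB _ _))// mulr_natl mulr2n lerD//.
    apply: mean_bound => //; last exact: kernel_op_bound.
    have bf : bmeas f by split => //; exists M.
    by case: (bmeas_kernel_op P bf).
  exact: mean_bound.
- move=> A mA; rewrite /L mean_indic// -[fine _]/(fine (pi A)) -(sP _ mA).
  rewrite /Rintegral; apply/eqP; rewrite subr_eq0.
  apply/eqP; congr fine; apply: eq_integral => x _.
  rewrite /kernel_op mean_indic// fineK//.
  exact: (kernel_finite_transition x).
Qed.

(** Reversibility is the case of two indicators. The defect [L] is bilinear and antisymmetric: its
    second argument is extended first, then antisymmetry lets the same argument extend the other
    one. *)
Lemma mean_kernel_opM (f g : T -> R) : reversible P pi -> bmeas f -> bmeas g ->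
  \int[pi]_x (f x * kernel_op P g x) = \int[pi]_x (kernel_op P f x * g x).
Proof.
move=> rP bf bg; have b1 := @bmeas_kernel_op _ _ _ _ _ P.
pose L f g := \int[pi]_x (f x * kernel_op P g x) -
  \int[pi]_x (kernel_op P f x * g x).
have LDr h u v : bmeas h -> bmeas u -> bmeas v ->
    L h (fun x => u x + v x) = L h u + L h v.
  move=> bh bu bv; rewrite /L kernel_opD//.
  under eq_Rintegral do rewrite mulrDr.
  under [X in _ - X]eq_Rintegral do rewrite mulrDr.
  by rewrite !meanD//; try (by apply: bmeasM => //; exact: b1); lra.
have LZr a h u : bmeas h -> bmeas u -> L h (fun x => a * u x) = a * L h u.
  move=> bh bu; rewrite /L kernel_opZ//.
  under eq_Rintegral do rewrite mulrCA.
  under [X in _ - X]eq_Rintegral do rewrite mulrCA.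
  by rewrite !meanZ//; try (by apply: bmeasM => //; exact: b1); lra.
have LC h u : L u h = - L h u.
  rewrite /L opprB; congr (_ - _); apply: eq_Rintegral => x _; exact: mulrC.
have Lb (h : T -> R) (N : R) (u : T -> R) (M : R) :
    measurable_fun [set: T] h -> (forall x, `|h x| <= N) ->
    measurable_fun [set: T] u -> (forall x, `|u x| <= M) ->
    `|L h u| <= 2 * N * M.
  move=> mh hN mu uM; rewrite (le_trans (ler_normB _ _))//.
  have bh : bmeas h by split => //; exists N.
  have bu : bmeas u by split => //; exists M.
  rewrite -mulrA mulr_natl mulr2n lerD//; apply: mean_bound => //.
  - by case: (bmeasM bh (b1 _ bu)).
  - by move=> x; rewrite normrM ler_pM//; exact: kernel_op_bound.
  - by case: (bmeasM (b1 _ bh) bu).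
  - by move=> x; rewrite normrM ler_pM//; exact: kernel_op_bound.
have LAB A B : measurable A -> measurable B -> L \1_A \1_B = 0.
  move=> mA mB; apply/eqP; rewrite subr_eq0; apply/eqP; rewrite /Rintegral.
  have int1 C D : measurable C -> measurable D ->
      (\int[pi]_x (\1_C x * kernel_op P \1_D x)%:E =
       \int[pi]_(x in C) P x D)%E.
    move=> mC mD; rewrite [RHS]integral_mkcond; apply: eq_integral => x _.
    rewrite /patch indicE; case: (x \in C); last by rewrite mul0r.
    rewrite mul1r /kernel_op mean_indic// fineK//.
    exact: (kernel_finite_transition x).
  under [X in _ = fine X]eq_integral do rewrite mulrC.
  by rewrite !int1// rP.
have LA A u : measurable A -> bmeas u -> L \1_A u = 0.
  move=> mA; have [m1 [N N1]] := @bmeas_indic R _ _ _ mA.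
  move: u; apply: (@bmeas_functional_eq0 _ _ _ (L \1_A) (2 * N)).
  - by move=> u v bu bv; apply: LDr => //; exact: bmeas_indic.
  - by move=> a u bu; apply: LZr => //; exact: bmeas_indic.
  - by move=> u M mu uM; exact: Lb.
  - by move=> B mB; exact: LAB.
apply/eqP; rewrite -subr_eq0 -/(L f g) LC oppr_eq0; apply/eqP.
have [mg [N gN]] := bg.
move: f bf; apply: (@bmeas_functional_eq0 _ _ _ (L g) (2 * N)).
- by move=> u v bu bv; exact: LDr.
- by move=> a u bu; exact: LZr.
- by move=> u M mu uM; exact: Lb.
- by move=> B mB; rewrite LC LA// oppr0.
Qed.

End reversible_kernel.

(** * The module of bounded functions and its covariance form *)

Section bounded_functions.
Context (R : realType) d (T : measurableType d).

Definition bmeas_pred : {pred T -> R} := mem [set f : T -> R | bmeas f].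

Lemma bmeas_submod_closed : submod_closed bmeas_pred.
Proof.
split=> [|a f g]; rewrite !inE/=; first exact: bmeas_cst.
by move=> bf bg; apply: bmeasD => //; exact: bmeasZ.
Qed.

HB.instance Definition _ :=
  GRing.isSubmodClosed.Build R (T -> R) bmeas_pred bmeas_submod_closed.

(** Genuine functions, not classes modulo [pi]: [P] acts on them pointwise, and the covariance is
    only semidefinite, which suffices for the abstract results on symmetric contractions. *)
Record bfun := Bfun { bfun_val :> T -> R; bfun_valP : bfun_val \in bmeas_pred }.

HB.instance Definition _ := [isSub for bfun_val].
HB.instance Definition _ := [Choice of bfun by <:].
HB.instance Definition _ := [SubChoice_isSubLmodule of bfun by <:].

Lemma bfunP (f : bfun) : bmeas f.
Proof. by have := bfun_valP f; rewrite inE. Qed.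

Lemma bfun_eq (f g : bfun) : (f : T -> R) = g -> f = g.
Proof. by move=> fg; exact: val_inj. Qed.

Lemma bfunDE (f g : bfun) x : (f + g) x = f x + g x.
Proof. by []. Qed.

Definition bfun_of (f : T -> R) (bf : bmeas f) : bfun := Bfun (mem_set bf).

End bounded_functions.

Section bfun_operator.
Context (R : realType) d (T : measurableType d).
Variable P : R.-pker T ~> T.
Implicit Types f g : bfun R T.

Definition bfun_op f : bfun R T := bfun_of (bmeas_kernel_op P (bfunP f)).

Let bfun_op_linear : linear bfun_op.
Proof.
move=> a f g; apply: bfun_eq => /=.
have bf := bfunP f; have bg := bfunP g.
rewrite [LHS](kernel_opD P (bmeasZ a bf) bg) kernel_opZ//.
Qed.

HB.instance Definition _ :=
  GRing.isLinear.Build R (bfun R T) (bfun R T) *:%R bfun_op bfun_op_linear.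

Lemma kernel_op_sqr (a s : R) (f : T -> R) x : bmeas f ->
  kernel_op P (fun y => (a + s * f y) ^+ 2) x =
  a ^+ 2 + 2 * a * s * kernel_op P f x + s ^+ 2 * kernel_op P (fun y => f y ^+ 2) x.
Proof.
move=> bf; have P1 : P x [set: T] = 1%E by exact: prob_kernel.
rewrite /kernel_op; have b2 := bmeas_sqr bf; have bc := @bmeas_cst R _ T (a ^+ 2).
rewrite (_ : (fun y => _) = fun y =>
    a ^+ 2 + 2 * a * s * f y + s ^+ 2 * f y ^+ 2); last by apply/funext => y; ring.
by rewrite !meanD ?meanZ ?mean_cst//; bmeas_tac.
Qed.

End bfun_operator.

Section bfun_covariance.
Context (R : realType) d (T : measurableType d).
Variable pi : probability T R.
Let pi1 : pi [set: T] = 1%E := probability_setT pi.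
Implicit Types f g : bfun R T.

Definition bcov f g : R :=
  \int[pi]_x (f x * g x) - (\int[pi]_x f x) * \int[pi]_x g x.

Lemma bcovC f g : bcov f g = bcov g f.
Proof.
rewrite /bcov [X in _ - X]mulrC; congr (_ - _).
by apply: eq_Rintegral => x _; rewrite mulrC.
Qed.

Lemma bcovE f : bcov f f = \int[pi]_x (f x ^+ 2) - (\int[pi]_x f x) ^+ 2.
Proof. by []. Qed.

Lemma bcovDl f g h : bcov (f + g) h = bcov f h + bcov g h.
Proof.
have bf := bfunP f; have bg := bfunP g; have bh := bfunP h.
rewrite /bcov -[\int[pi]_x (f + g) x]/(\int[pi]_x (f x + g x)) meanD//.
rewrite -[\int[pi]_x ((f + g) x * h x)]/(\int[pi]_x ((f x + g x) * h x)).
under eq_Rintegral do rewrite mulrDl.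
by rewrite meanD//; [ring|exact: bmeasM|exact: bmeasM].
Qed.

Lemma bcovZl a f g : bcov (a *: f) g = a * bcov f g.
Proof.
have bf := bfunP f; have bg := bfunP g.
rewrite /bcov -[\int[pi]_x (a *: f) x]/(\int[pi]_x (a * f x)) meanZ//.
rewrite -[\int[pi]_x ((a *: f) x * g x)]/(\int[pi]_x (a * f x * g x)).
under eq_Rintegral do rewrite -mulrA.
by rewrite meanZ//; [ring|exact: bmeasM].
Qed.

Section reversible.
Variable P : R.-pker T ~> T.
Hypothesis sP : stationary P pi.
Hypothesis rP : reversible P pi.

Lemma mean_bfun_op f : \int[pi]_x bfun_op P f x = \int[pi]_x f x.
Proof. exact: (mean_kernel_op sP (bfunP f)). Qed.

Lemma bcov_sym f g : bcov f (bfun_op P g) = bcov (bfun_op P f) g.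
Proof.
rewrite /bcov !mean_bfun_op; congr (_ - _).
exact: (mean_kernel_opM rP (bfunP f) (bfunP g)).
Qed.

(** One expansion for two uses. [s = -1], [c = 0] gives the Dirichlet form and the upper bound of
    [<f, P f>]; [s = 1] with [c] twice the mean of [f] gives the lower bound [- <f, f>]. *)
Lemma mean_kernel_op_sqr f (c s : R) :
  \int[pi]_x kernel_op P (fun y => (f x - c + s * f y) ^+ 2) x =
  (1 + s ^+ 2) * \int[pi]_x (f x ^+ 2) + 2 * s * \int[pi]_x (f x * bfun_op P f x)
  - 2 * (1 + s) * c * \int[pi]_x f x + c ^+ 2.
Proof.
have bf := bfunP f; have bPf := bfunP (bfun_op P f); have b2 := bmeas_sqr bf.
have bP2 := bmeas_kernel_op P b2.
have -> : (fun x => kernel_op P (fun y => (f x - c + s * f y) ^+ 2) x) =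
   (fun x => f x ^+ 2 + - (2 * c) * f x + c ^+ 2 +
     2 * s * (f x * bfun_op P f x) + - (2 * s * c) * bfun_op P f x +
     s ^+ 2 * kernel_op P (fun y => f y ^+ 2) x).
  apply/funext => x; rewrite kernel_op_sqr// -[kernel_op P f x]/(bfun_op P f x).
  ring.
have bc := @bmeas_cst R _ T.
have bfP := bmeasM bf bPf.
rewrite !meanD ?meanZ//; try by bmeas_tac.
rewrite mean_cst// mean_bfun_op (mean_kernel_op sP b2); ring.
Qed.

Lemma dirichlet_form f :
  \int[pi]_x kernel_op P (fun y => (f x - f y) ^+ 2) x =
  2 * (bcov f f - bcov f (bfun_op P f)).
Proof.
have := mean_kernel_op_sqr f 0 (-1).
rewrite bcovE /bcov mean_bfun_op.
under [in X in X -> _]eq_Rintegral => x _ do under eq_fun do rewrite subr0 mulN1r.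
by move=> ->; ring.
Qed.

Lemma bcov_contr f : `|bcov f (bfun_op P f)| <= bcov f f.
Proof.
have h0 c s : 0 <= \int[pi]_x kernel_op P (fun y => (f x - c + s * f y) ^+ 2) x.
  apply: Rintegral_ge0 => x _; apply: Rintegral_ge0 => y _; exact: sqr_ge0.
have := h0 0 (-1); have := h0 (2 * \int[pi]_x f x) 1.
rewrite !mean_kernel_op_sqr bcovE /bcov mean_bfun_op.
by rewrite ler_norml => h1 h2; apply/andP; split; lra.
Qed.

End reversible.
End bfun_covariance.

(** * Comparison of Dirichlet forms under off-diagonal domination *)

Section peskun.
Context (R : realType) d (T : measurableType d).
Variables P1 P2 : R.-pker T ~> T.
Hypothesis P12 : dominates_off_diagonal P1 P2.

(* Off-diagonal domination compares the two laws on the set where [g] does not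
   vanish, which misses [x]; the singleton [x] need not be measurable. *)
Lemma le_kernel_op (g : T -> R) x : bmeas g -> (forall y, 0 <= g y) -> g x = 0 ->
  kernel_op P2 g x <= kernel_op P1 g x.
Proof.
move=> bg g0 gx; have [mg _] := bg.
pose A := ~` (g @^-1` [set 0]).
have mA : measurable A.
  by apply: measurableC; rewrite -[X in measurable X]setTI; exact: mg.
(* Since [g] vanishes off [A], the measure itself may be restricted to [A]. Domination then holds on
   every measurable set, whose intersection with [A] misses [x]. *)
have restr (P : R.-pker T ~> T) :
    (\int[P x]_y (g y)%:E = \int[mrestr (P x) mA]_(y in A) (g y)%:E)%E.
  transitivity (\int[P x]_(y in A) (g y)%:E)%E; last first.
    apply: eq_measure_integral => B mB BA.
    by rewrite -[RHS]/(P x (B `&` A)) (setIidl BA).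
  rewrite [RHS]integral_mkcond; apply: eq_integral => y _.
  rewrite /patch; case: ifPn => // /negP yA; congr EFin; apply: contrapT => gy.
  by apply: yA; rewrite inE.
rewrite /kernel_op -lee_fin !EFin_mean//; try exact: prob_kernel.
rewrite !restr; apply: ge0_le_measure_integral => //.
- by move=> S mS; apply: P12; [exact: measurableI|case=> _; exact].
- by apply/measurable_EFinP.
Qed.

(** For each [x], the function [y |-> (f x - f y)^2] is nonnegative and vanishes at [x], so its two
    kernel means compare pointwise before integration against [pi]. *)
Lemma bcov_dirichlet_le (pi : probability T R) f :
  stationary P1 pi -> stationary P2 pi ->
  bcov pi f f - bcov pi f (bfun_op P2 f) <= bcov pi f f - bcov pi f (bfun_op P1 f).
Proof.
move=> s1 s2; rewrite -(@ler_pM2l _ 2)// -!dirichlet_form//.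
have bf := bfunP f.
have b (P : R.-pker T ~> T) :
    bmeas (fun x => kernel_op P (fun y => (f x - f y) ^+ 2) x).
  apply: (@bmeas_kernel_mean _ _ _ _ _ P (fun z => (f z.1 - f z.2) ^+ 2)).
  apply/bmeas_sqr/bmeasB.
    by apply: (bmeas_comp _ bf); exact: measurable_fst.
  by apply: (bmeas_comp _ bf); exact: measurable_snd.
apply: le_mean => //; first exact: probability_setT.
move=> x; apply: le_kernel_op => [| |]; last by rewrite subrr expr0n.
  by bmeas_tac.
by move=> y; exact: sqr_ge0.
Qed.

End peskun.

(** * Partial sums along the chain *)

Lemma Lfun2_sqr (R : realType) d (S : measurableType d)
    (mu : {measure set S -> \bar R}) (f : S -> R) :
  measurable_fun [set: S] f -> (\int[mu]_x (f x ^+ 2)%:E < +oo)%E ->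
  f \in Lfun mu 2%:E.
Proof.
move=> mf f2; rewrite inE; apply/andP; split; rewrite inE//=.
rewrite /finite_norm unlock poweR_lty//; apply: le_lt_trans f2.
rewrite le_eqVlt; apply/orP; left; apply/eqP/eq_integral => x _.
by rewrite /= powR_mulrn// real_normK ?num_real.
Qed.

Lemma Lfun_bmeas (R : realType) d (S : measurableType d)
    (nu : probability S R) (F : S -> R) :
  bmeas F -> F \in Lfun nu 2%:E.
Proof.
move=> bF; apply: Lfun2_sqr; first by case: bF.
rewrite -EFin_mean ?ltry//; first exact: probability_setT.
exact: bmeas_sqr.
Qed.

Lemma variance_bmeas (R : realType) d (S : measurableType d)
    (nu : probability S R) (F : S -> R) : bmeas F ->
  'V_nu[F]%E = (\int[nu]_x (F x ^+ 2) - (\int[nu]_x F x) ^+ 2)%:E.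
Proof.
move=> bF; rewrite varianceE; last exact: Lfun_bmeas.
have nu1 : nu [set: S] = 1%E := probability_setT nu.
rewrite unlock EFinB EFin_expe; congr (_ - _ ^+ 2)%E.
  by rewrite EFin_mean//; exact: bmeas_sqr.
by rewrite EFin_mean.
Qed.

Section path_expectation.
Context (R : realType) d (T : measurableType d).
Variable P : R.-pker T ~> T.

(** The Markov property: on indicators this is the definition of [path_step], and linearity with
    uniform limits does the rest. *)
Lemma mean_path_step n (mu : probability (n.+1.-tuple T) R)
    (F : n.+2.-tuple T -> R) : bmeas F ->
  \int[path_step P mu]_t F t =
  \int[mu]_t \int[P (tnth t ord_max)]_x F (tuple_rcons (t, x)).
Proof.
pose G (F : n.+2.-tuple T -> R) (t : n.+1.-tuple T) :=
  \int[P (tnth t ord_max)]_x F (tuple_rcons (t, x)).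
have mr (t : n.+1.-tuple T) : measurable_fun [set: T] (fun x => tuple_rcons (t, x)).
  apply: measurableT_comp; first exact: measurable_tuple_rcons.
  exact: measurable_pair1.
have bG (F' : n.+2.-tuple T -> R) : bmeas F' -> bmeas (G F').
  move=> bF; apply: (@bmeas_kernel_mean _ _ _ _ _ (last_kernel P (n := n))
    (F' \o @tuple_rcons _ T n.+1)).
  by apply: bmeas_comp bF; exact: measurable_tuple_rcons.
have bFt (F' : n.+2.-tuple T -> R) (t : n.+1.-tuple T) : bmeas F' ->
    bmeas (fun x : T => F' (tuple_rcons (t, x))).
  by move=> bF; exact: (bmeas_comp (mr t) bF).
have p1 x : P x [set: T] = 1%E by exact: prob_kernel.
have mu1 : mu [set: _] = 1%E := probability_setT mu.
have st1 : path_step P mu [set: _] = 1%E := probability_setT (path_step P mu).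
pose L (F : n.+2.-tuple T -> R) := \int[path_step P mu]_t F t - \int[mu]_t G F t.
move=> bF; apply/eqP; rewrite -subr_eq0 -/(L F); apply/eqP; move: F bF.
apply: (@bmeas_functional_eq0 _ _ _ L 2).
- move=> f g bf bg; rewrite /L meanD//.
  rewrite (_ : G _ = fun t => G f t + G g t); last first.
    by apply/funext => t; rewrite /G meanD//; exact: bFt.
  by rewrite meanD//; [ring|exact: bG|exact: bG].
- move=> a f bf; rewrite /L meanZ//.
  rewrite (_ : G _ = fun t => a * G f t); last first.
    by apply/funext => t; rewrite /G meanZ//; exact: bFt.
  by rewrite meanZ//; [ring|exact: bG].
- move=> f M mf fM; rewrite (le_trans (ler_normB _ _))// mulr_natl mulr2n.
  have bf : bmeas f by split => //; exists M.
  rewrite lerD//; apply: mean_bound => //; first by case: (bG f bf).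
  by move=> t; apply: mean_bound => //; case: (bFt f t bf).
- move=> A mA; rewrite /L mean_indic// -[fine _]/(fine (path_step P mu A)).
  apply/eqP; rewrite subr_eq0; apply/eqP; rewrite /path_step /Rintegral.
  congr fine; apply: eq_integral => t _; rewrite /G.
  pose B := [set x | A (tuple_rcons (t, x))].
  have mB : measurable B by rewrite -[B]setTI; exact: mr.
  rewrite -[X in _ = X%:E]/(\int[P (tnth t ord_max)]_x \1_B x) mean_indic//.
  by rewrite fineK//; exact: (kernel_finite_transition (tnth t ord_max)).
Qed.

Lemma tnth_tuple_rcons_last n (t : n.-tuple T) x :
  tnth (tuple_rcons (t, x)) ord_max = x.
Proof. by rewrite (tnth_nth x)/= nth_rcons size_tuple ltnn eqxx. Qed.

Lemma tnth_tuple_rcons_widen n (t : n.-tuple T) x (i : 'I_n) (j : 'I_n.+1) :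
  i = j :> nat -> tnth (tuple_rcons (t, x)) j = tnth t i.
Proof.
by move=> ij; rewrite !(tnth_nth x)/= nth_rcons size_tuple -ij ltn_ord.
Qed.

Lemma path_sum_rcons (h : T -> R) n (t : n.+1.-tuple T) x :
  path_sum h (tuple_rcons (t, x)) = path_sum h t + h x.
Proof.
rewrite /path_sum big_ord_recr/=; congr (_ + h _).
  by apply: eq_bigr => i _; congr (h _); exact: tnth_tuple_rcons_widen.
by rewrite (_ : lift _ _ = ord_max) ?tnth_tuple_rcons_last//; exact: val_inj.
Qed.

Lemma bmeas_tnth n (i : 'I_n) (f : T -> R) : bmeas f ->
  bmeas (fun t : n.-tuple T => f (tnth t i)).
Proof. by move=> bf; apply: bmeas_comp bf; exact: measurable_tnth. Qed.

Lemma bmeas_path_sum n (f : T -> R) : bmeas f -> bmeas (@path_sum _ T R f n).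
Proof. by move=> bf; apply: bmeas_sum => i; exact: bmeas_tnth. Qed.

Variable pi : probability T R.
Hypothesis sP : stationary P pi.
Local Notation mu n := (path_law P pi n).

Let mu1 n : mu n [set: _] = 1%E.
Proof. exact: probability_setT. Qed.
Let pi1 : pi [set: T] = 1%E := probability_setT pi.
Let P1 x : P x [set: T] = 1%E.
Proof. exact: prob_kernel. Qed.

Lemma mean_path_law0 (F : 1.-tuple T -> R) : bmeas F ->
  \int[mu 0]_t F t = \int[pi]_x F (tuple_sing x).
Proof.
move=> bF; have [mF _] := bF; rewrite /Rintegral /=; congr fine.
rewrite integral_distribution//; first exact/measurable_EFinP.
apply: (@bmeas_integrable _ _ _ pi pi1 (F \o @tuple_sing _ T)).
by apply: bmeas_comp bF; exact: measurable_tuple_sing.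
Qed.

Lemma mean_path_lawS n (F : n.+2.-tuple T -> R) : bmeas F ->
  \int[mu n.+1]_t F t =
  \int[mu n]_t \int[P (tnth t ord_max)]_x F (tuple_rcons (t, x)).
Proof. exact: mean_path_step. Qed.

Lemma mean_path_last n (f : T -> R) : bmeas f ->
  \int[mu n]_t f (tnth t ord_max) = \int[pi]_x f x.
Proof.
elim: n f => [|n IH] f bf.
  rewrite mean_path_law0; last exact: bmeas_tnth.
  by apply: eq_Rintegral => x _; rewrite ord1.
rewrite mean_path_lawS; last exact: bmeas_tnth.
under eq_Rintegral => t _ do under eq_Rintegral do rewrite tnth_tuple_rcons_last.
by rewrite (IH (kernel_op P f)) ?mean_kernel_op//; exact: bmeas_kernel_op.
Qed.

Lemma mean_path_sum n (f : T -> R) : bmeas f ->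
  \int[mu n]_t path_sum f t = n%:R * \int[pi]_x f x.
Proof.
move=> bf; elim: n => [|n IH].
  by rewrite mul0r; under eq_Rintegral do rewrite /path_sum big_ord0;
    exact: (mean_cst (mu1 0)).
rewrite mean_path_lawS; last exact: bmeas_path_sum.
rewrite (_ : (fun t => _) = fun t : n.+1.-tuple T =>
    path_sum f t + kernel_op P f (tnth t ord_max)); last first.
  apply/funext => t; under eq_Rintegral do rewrite path_sum_rcons.
  by rewrite meanD ?mean_cst//; exact: bmeas_cst.
have bPf := bmeas_kernel_op P bf; have bPl := @bmeas_tnth n.+1 ord_max _ bPf.
rewrite (meanD (mu1 n))//; last exact: bmeas_path_sum.
by rewrite IH mean_path_last// mean_kernel_op// -natr1 mulrDl mul1r.
Qed.

(** The cross term of the variance recursion. Conditioning on all but the last coordinate turns [g]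
    into [P g] against the earlier sum and adds the mean of [f g]; this matches
    [S n.+1 g = g + S n (P g)]. *)
Lemma mean_path_sumM n (f g : bfun R T) :
  \int[mu n]_t (path_sum f t * g (tnth t ord_max)) =
  \int[pi]_x (f x * iterates_sum (bfun_op P) n g x).
Proof.
have bf := bfunP f.
elim: n g => [|n IH] g; have bg := bfunP g.
  rewrite /iterates_sum big_ord0.
  under eq_Rintegral do rewrite /path_sum big_ord0 mul0r.
  under [RHS]eq_Rintegral do rewrite mulr0.
  by rewrite (mean_cst (mu1 0)) mean_cst.
have bS := bmeas_path_sum n.+1 bf; have bg' := @bmeas_tnth n.+2 ord_max g bg.
rewrite mean_path_lawS; last by bmeas_tac.
rewrite (_ : (fun t => _) = fun t : n.+1.-tuple T =>
    path_sum f t * bfun_op P g (tnth t ord_max) +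
    kernel_op P (fun x => f x * g x) (tnth t ord_max)); last first.
  apply/funext => t.
  under eq_Rintegral do rewrite path_sum_rcons tnth_tuple_rcons_last mulrDl.
  by rewrite meanD ?meanZ//; bmeas_tac.
have bPg := bfunP (bfun_op P g); have bfg := bmeasM bf bg.
have bPfg := bmeas_kernel_op P bfg.
have bt := @bmeas_tnth n.+1 ord_max.
have bSn := bmeas_path_sum n bf.
rewrite (meanD (mu1 n)); [|by apply: bmeasM => //; exact: bt|exact: bt].
rewrite IH mean_path_last// mean_kernel_op//.
have bSg := bfunP (iterates_sum (bfun_op P) n (bfun_op P g)).
rewrite -meanD//; [|exact: bmeasM].
apply: eq_Rintegral => x _.
by rewrite iterates_sum_recl linear_iterates_sum bfunDE mulrDr addrC.
Qed.

(** Expanding the square of the sum with one more term and conditioning on the past reproduces the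
    recursion of [path_form]; the last summand accounts for [f] not being centred. *)
Lemma mean_path_sum_sqr n (f : bfun R T) :
  \int[mu n]_t (path_sum f t ^+ 2) =
  path_form (bcov pi) (bfun_op P) n f f + (n%:R * \int[pi]_x f x) ^+ 2.
Proof.
have bf := bfunP f; have b2 := bmeas_sqr bf.
elim: n => [|n IH].
  under eq_Rintegral do rewrite /path_sum big_ord0 expr0n.
  by rewrite (mean_cst (mu1 0))//= mul0r expr0n addr0.
have bS := bmeas_path_sum n.+1 bf; have bSn := bmeas_path_sum n bf.
rewrite mean_path_lawS; last by bmeas_tac.
rewrite (_ : (fun t => _) = fun t : n.+1.-tuple T => path_sum f t ^+ 2 +
    2 * (path_sum f t * bfun_op P f (tnth t ord_max)) +
    kernel_op P (fun x => f x ^+ 2) (tnth t ord_max)); last first.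
  apply/funext => t.
  under eq_Rintegral do rewrite path_sum_rcons -[f _]mul1r.
  rewrite [LHS](kernel_op_sqr P (path_sum f t) 1 (tnth t ord_max) bf).
  by rewrite expr1n mul1r mulr1 mulrA.
have bPf := @bmeas_tnth n.+1 ord_max _ (bfunP (bfun_op P f)).
have bP2 := @bmeas_tnth n.+1 ord_max _ (bmeas_kernel_op P b2).
rewrite !(meanD (mu1 n)) ?(meanZ (mu1 n))//; try by bmeas_tac.
rewrite IH mean_path_sumM mean_path_last; last exact: bmeas_kernel_op.
rewrite mean_kernel_op// path_form_quad bcovE /bcov mean_bfun_op//.
have -> : \int[pi]_x iterates_sum (bfun_op P) n f x = n%:R * \int[pi]_x f x.
  elim: n {IH bS bSn bPf bP2} => [|n IH].
    by rewrite /iterates_sum big_ord0 mul0r; exact: mean_cst.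
  rewrite iterates_sumS -natr1 mulrDl mul1r -{}IH.
  rewrite -[\int[pi]_x (_ + _) x]/(\int[pi]_x (iterates_sum (bfun_op P) n f x +
    iter n (bfun_op P) f x)) meanD//; try exact: bfunP.
  by congr (_ + _); elim: n => //= n IH; rewrite mean_bfun_op.
rewrite linear_iterates_sum -natr1; ring.
Qed.

Lemma variance_path_sum n (f : bfun R T) :
  'V_(mu n)[@path_sum _ T R f n]%E =
  (path_form (bcov pi) (bfun_op P) n f f)%:E.
Proof.
have bf := bfunP f.
rewrite variance_bmeas; last exact: bmeas_path_sum.
by rewrite mean_path_sum_sqr mean_path_sum// addrK.
Qed.

Lemma variance_bcov (f : bfun R T) : 'V_pi[f]%E = (bcov pi f f)%:E.
Proof. by rewrite variance_bmeas//; exact: bfunP. Qed.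

End path_expectation.

(** * Passage to square-integrable functions *)

Section real_variance.
Context (R : realType) d (S : measurableType d) (mu : probability S R).
Implicit Types X Y : S -> R.

Lemma LfunD X Y : X \in Lfun mu 2%:E -> Y \in Lfun mu 2%:E ->
  (X \+ Y) \in Lfun mu 2%:E.
Proof. by move=> X2 Y2; rewrite rpredD ?lee1n. Qed.

Lemma LfunB X Y : X \in Lfun mu 2%:E -> Y \in Lfun mu 2%:E ->
  (X \- Y) \in Lfun mu 2%:E.
Proof. by move=> X2 Y2; rewrite rpredB ?lee1n. Qed.

Lemma Lfun_sum (I : Type) (r : seq I) (F : I -> S -> R) :
  (forall i, F i \in Lfun mu 2%:E) ->
  (fun x => \sum_(i <- r) F i x) \in Lfun mu 2%:E.
Proof.
move=> F2; elim: r => [|i r IH].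
  by under eq_fun do rewrite big_nil; exact: Lfun_cst.
by under eq_fun do rewrite big_cons; exact: LfunD.
Qed.

(** [fine] sends an infinite variance to 0, so upper bounds on [rvar] are informative for
    square-integrable functions, where [rvarE] recovers the true variance. *)
Definition rvar X : R := fine 'V_mu[X]%E.

Lemma rvarE X : X \in Lfun mu 2%:E -> 'V_mu[X]%E = (rvar X)%:E.
Proof. by move=> X2; rewrite /rvar fineK// variance_fin_num. Qed.

Lemma rvar_ge0 X : 0 <= rvar X.
Proof. by rewrite fine_ge0// variance_ge0. Qed.

Let rcov X Y : R := fine (covariance mu X Y).

Let rcovE X Y : X \in Lfun mu 2%:E -> Y \in Lfun mu 2%:E ->
  covariance mu X Y = (rcov X Y)%:E.
Proof.
move=> X2 Y2; have Pfin := fin_num_measure mu _ measurableT.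
by rewrite /rcov fineK// covariance_fin_num ?Lfun2_mul_Lfun1 ?Lfun_subset12.
Qed.

(** Dividing [Var(t X - Y) >= 0] by [t] bounds twice the covariance. [t = 1] serves for crude
    bounds, and a small [t] makes the coefficient of [rvar X] close to 1. *)
Lemma rvarD_le X Y t : X \in Lfun mu 2%:E -> Y \in Lfun mu 2%:E -> 0 < t ->
  rvar (X \+ Y) <= (1 + t) * rvar X + (1 + t^-1) * rvar Y.
Proof.
move=> X2 Y2 t0.
have Pfin := fin_num_measure mu _ measurableT.
have tX2 : (t \o* X) \in Lfun mu 2%:E by rewrite Lfun_scale// ler1n.
have XY2 : (X \+ Y) \in Lfun mu 2%:E := LfunD X2 Y2.
have tXY2 : ((t \o* X) \- Y) \in Lfun mu 2%:E := LfunB tX2 Y2.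
have [X1 Y1] := (Lfun_subset12 Pfin X2, Lfun_subset12 Pfin Y2).
have e1 := varianceD X2 Y2.
rewrite (rvarE X2) (rvarE Y2) (rvarE XY2) (rcovE X2 Y2) -EFinM -!EFinD in e1.
have e2 := varianceB tX2 Y2.
rewrite varianceZ// covarianceZl// in e2; last exact: Lfun2_mul_Lfun1.
rewrite (rvarE X2) (rvarE Y2) (rvarE tXY2) (rcovE X2 Y2) -!EFinM in e2.
case: e1 => ->; case: e2 => e2; have := rvar_ge0 ((t \o* X) \- Y).
rewrite e2 => h.
have : 0 <= t^-1 * (t ^+ 2 * rvar X + rvar Y - 2 * (t * rcov X Y)).
  by rewrite mulr_ge0// invr_ge0 ltW.
have -> : t^-1 * (t ^+ 2 * rvar X + rvar Y - 2 * (t * rcov X Y)) =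
    t * rvar X + t^-1 * rvar Y - 2 * rcov X Y by field; rewrite gt_eqF.
by move: (t^-1) => u; lra.
Qed.

Lemma rvarN X : X \in Lfun mu 2%:E -> rvar (\- X) = rvar X.
Proof. by move=> X2; rewrite /rvar varianceN. Qed.

Lemma rvarB_le X Y t : X \in Lfun mu 2%:E -> Y \in Lfun mu 2%:E -> 0 < t ->
  rvar (X \- Y) <= (1 + t) * rvar X + (1 + t^-1) * rvar Y.
Proof. by move=> X2 Y2 t0; rewrite -(rvarN Y2) rvarD_le// rpredN. Qed.

Lemma rvar_le_sqr X M : X \in Lfun mu 2%:E ->
  (\int[mu]_x (X x ^+ 2)%:E <= M%:E)%E -> rvar X <= M.
Proof.
move=> X2 XM; rewrite -lee_fin -rvarE// varianceE//; apply: le_trans XM.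
have := expectation_fin_num (Lfun_subset12 (fin_num_measure mu _ measurableT) X2).
rewrite unlock => Xfin; rewrite leeBlDr; last first.
  by rewrite -(fineK Xfin) -EFin_expe.
by rewrite leeDl// -(fineK Xfin) -EFin_expe lee_fin sqr_ge0.
Qed.

(** The exponential factor is harmless: the bound serves at a fixed length, with [M] chosen
    afterwards. *)
Lemma rvar_sum_le (I : Type) (r : seq I) (F : I -> S -> R) M :
  0 <= M -> (forall i, F i \in Lfun mu 2%:E) -> (forall i, rvar (F i) <= M) ->
  rvar (fun x => \sum_(i <- r) F i x) <= 4 ^+ size r * M.
Proof.
move=> M0 F2 FM; elim: r => [|i r IH] /=.
  under eq_fun do rewrite big_nil.
  by rewrite /rvar variance_cst mul1r.
under eq_fun do rewrite big_cons.
have S2 := Lfun_sum r F2.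
apply: (le_trans (rvarD_le (F2 i) S2 ltr01)); rewrite invr1 exprS.
have r1 : 1 <= 4 ^+ size r :> R by rewrite exprn_ege1// ler1n.
have := FM i; have := ler_wpM2r M0 r1; rewrite mul1r -mulrA.
move: (_ * M) (rvar _) (rvar _) IH => *; lra.
Qed.

End real_variance.

Section truncation.
Context (R : realType) d (T : measurableType d) (pi : probability T R).

(** Truncation to the set where [|f| <= n]: the squared error is dominated by [f^2] and is
    eventually zero at each point. *)
Lemma bfun_dense (f : T -> R) (e : R) : f \in Lfun pi 2%:E -> 0 < e ->
  exists b : bfun R T, (\int[pi]_x ((f x - b x) ^+ 2)%:E <= e%:E)%E.
Proof.
move=> f2 e0.
have mf : measurable_fun [set: T] f.
  by move: f2; rewrite inE => /andP[]; rewrite inE.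
pose A n := [set x | `|f x| <= n%:R].
have mA n : measurable (A n).
  have : measurable_fun [set: T] (fun x => `|f x| <= n%:R).
    by apply: measurable_fun_ler => //; exact: measurableT_comp.
  by move=> /(_ measurableT [set true] ltac:(by [])); rewrite setTI.
have bb n : bmeas (fun x => f x * \1_(A n) x).
  split; first by apply: measurable_funM => //; exact: measurable_indic.
  exists n%:R => x; rewrite indicE; have [|_] := boolP (x \in A n).
    by rewrite inE mulr1.
  by rewrite mulr0 normr0.
pose F n x := ((f x - f x * \1_(A n) x) ^+ 2)%:E.
have mF n : measurable_fun [set: T] (F n).
  apply/measurable_EFinP/measurable_funX/measurable_funB => //.
  by case: (bb n).
have Fcvg : {ae pi, forall x, [set: T] x -> F ^~ x @ \oo --> 0%E}.
  apply: aeW => x _; apply: cvg_near_cst.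
  exists (Num.bound `|f x|) => // n /= hn; rewrite /F indicE mem_set /A/=.
    by rewrite mulr1 subrr expr0n.
  by rewrite (le_trans (ltW (archi_boundP _)))// ler_nat.
have Fle : {ae pi, forall x n, [set: T] x -> (`|F n x| <= (f x ^+ 2)%:E)%E}.
  apply: aeW => x n _; rewrite /F gee0_abs ?lee_fin ?sqr_ge0//.
  rewrite indicE; case: (_ \in _); last by rewrite mulr0 subr0.
  by rewrite mulr1 subrr expr0n sqr_ge0.
have [_ _] := dominated_convergence measurableT mF (measurable_cst _) Fcvg
  (Lfun2_integrable_sqr f2) Fle.
rewrite integral_cst// mul0e => /fine_cvgP[nf] /cvgrPdist_le/(_ _ e0) cF.
near \oo => n.
have fn : (\int[pi]_x F n x)%E \is a fin_num by near: n.
exists (bfun_of (bb n)); rewrite -[leLHS]/(\int[pi]_x F n x)%E -(fineK fn) lee_fin.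
have : `|0 - fine (\int[pi]_x F n x)%E| <= e by near: n.
by rewrite sub0r normrN; apply: le_trans; exact: ler_norm.
Unshelve. all: by end_near.
Qed.

End truncation.

Lemma cvgn_unif_approx (R : realType) (u : R^nat) :
  (forall e : R, 0 < e -> exists v : R^nat, cvgn v /\ forall n, `|u n - v n| <= e) ->
  cvgn u.
Proof.
move=> uv; apply/cauchy_cvgP/cauchy_exP => e e0.
have [v [/cvg_ex[/= l vl] uve]] := uv _ (divr_gt0 e0 (ltr0Sn R 1)).
exists l; have e2 : 0 < e / 2 by rewrite divr_gt0.
move/cvgrPdist_lt/(_ _ e2) : vl; apply: filterS => n /= lv.
rewrite /ball/= [e]splitr -(subrK (v n) l) -addrA.
by rewrite (le_lt_trans (ler_normD _ _))// ltr_leD// distrC.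
Qed.

(** * Extension of the bound and of the convergence to square-integrable functions *)

Section variance_bounding_L2.
Context (R : realType) d (T : measurableType d).
Variables (P : R.-pker T ~> T) (pi : probability T R).
Hypothesis sP : stationary P pi.
Local Notation mu n := (path_law P pi n).
Let mu1 n : mu n [set: _] = 1%E.
Proof. exact: probability_setT. Qed.

Lemma mean_path_tnth n (i : 'I_n.+1) (f : T -> R) : bmeas f ->
  \int[mu n]_t f (tnth t i) = \int[pi]_x f x.
Proof.
elim: n i => [|n IH] i bf.
  by rewrite (_ : i = ord_max); [exact: mean_path_last|rewrite !ord1].
have [in1|in1] := ltnP i n.+1; last first.
  rewrite (_ : i = ord_max); first exact: mean_path_last.
  by apply/val_inj/eqP; rewrite eqn_leq in1 -ltnS ltn_ord.
rewrite mean_path_lawS; last exact: bmeas_tnth.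
rewrite -(IH (Ordinal in1) bf); apply: eq_Rintegral => t _.
rewrite -[RHS](@mean_cst _ _ _ (P (tnth t ord_max))); last exact: prob_kernel.
by apply: eq_Rintegral => x _; congr f; exact: tnth_tuple_rcons_widen.
Qed.

Lemma path_law_tnth n (i : 'I_n.+1) (A : set T) : measurable A ->
  mu n [set t | A (tnth t i)] = pi A.
Proof.
move=> mA; have mB : measurable [set t : n.+1.-tuple T | A (tnth t i)].
  rewrite -[X in measurable X]setTI.
  exact: (@measurable_tnth _ T n.+1 i measurableT A mA).
have : \int[mu n]_t (\1_[set t : n.+1.-tuple T | A (tnth t i)] t) =
    \int[pi]_x (\1_A x) := mean_path_tnth i (bmeas_indic R mA).
rewrite !mean_indic//.
move=> e; have := congr1 EFin e.
by rewrite !fineK//; exact: fin_num_measure.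
Qed.

Lemma ge0_integral_path_tnth n (i : 'I_n.+1) (f : T -> \bar R) :
  measurable_fun [set: T] f -> (forall x, 0 <= f x)%E ->
  (\int[mu n]_t f (tnth t i) = \int[pi]_x f x)%E.
Proof.
move=> mf f0.
have mt := @measurable_tnth _ T n.+1 i.
rewrite -[LHS](@ge0_integral_pushforward _ _ _ _ _ _ mt (mu n) setT f measurableT)//.
by apply: eq_measure_integral => A mA _; exact: path_law_tnth.
Qed.

Lemma Lfun_path_tnth n (i : 'I_n.+1) (f : T -> R) : f \in Lfun pi 2%:E ->
  (fun t : n.+1.-tuple T => f (tnth t i)) \in Lfun (mu n) 2%:E.
Proof.
move=> f2; have mf : measurable_fun [set: T] f.
  by move: f2; rewrite inE => /andP[]; rewrite inE.
apply: Lfun2_sqr; first exact: measurableT_comp mf (measurable_tnth i).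
rewrite (@ge0_integral_path_tnth n i (fun x => (f x ^+ 2)%:E)).
- have /integrableP[_] := Lfun2_integrable_sqr f2; apply: le_lt_trans.
  by under [leRHS]eq_integral do rewrite /= ger0_norm ?sqr_ge0//.
- by apply/measurable_EFinP; exact: measurable_funX.
- by move=> x; rewrite lee_fin sqr_ge0.
Qed.

Lemma Lfun_path_sum n (f : T -> R) : f \in Lfun pi 2%:E ->
  @path_sum _ T R f n \in Lfun (mu n) 2%:E.
Proof. by move=> f2; apply: Lfun_sum => i; exact: Lfun_path_tnth. Qed.

Lemma rvar_path_sum_sqr n (f : T -> R) M : f \in Lfun pi 2%:E ->
  (\int[pi]_x (f x ^+ 2)%:E <= M%:E)%E ->
  rvar (mu n) (@path_sum _ T R f n) <= 4 ^+ n * M.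
Proof.
move=> f2 fM; have mf : measurable_fun [set: T] f.
  by move: f2; rewrite inE => /andP[]; rewrite inE.
have M0 : 0 <= M.
  rewrite -lee_fin; apply: le_trans fM; apply: integral_ge0 => x _.
  by rewrite lee_fin sqr_ge0.
rewrite -[X in 4 ^+ X]size_enum_ord.
rewrite [X in rvar _ X](_ : _ = fun t : n.+1.-tuple T =>
    \sum_(i <- enum 'I_n) f (tnth t (lift ord0 i))).
  apply: rvar_sum_le => // i; first exact: Lfun_path_tnth.
  apply: rvar_le_sqr; first exact: Lfun_path_tnth.
  rewrite (@ge0_integral_path_tnth n _ (fun x => (f x ^+ 2)%:E))//.
    by apply/measurable_EFinP; exact: measurable_funX.
  by move=> x; rewrite lee_fin sqr_ge0.
by apply/funext => t; rewrite big_enum.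
Qed.

Variable K : R.
Hypothesis K_ge0 : 0 <= K.
Hypothesis path_sum_le : forall n (b : bfun R T),
  rvar (mu n) (@path_sum _ T R b n) <= n%:R * (K * rvar pi b).

Let path_sumB n (f g : T -> R) : @path_sum _ T R (f \- g) n =
  @path_sum _ T R f n \- @path_sum _ T R g n.
Proof. by apply/funext => t; rewrite /path_sum /= sumrB. Qed.

Let path_sumK n (f g : T -> R) : @path_sum _ T R f n =
  @path_sum _ T R g n \+ @path_sum _ T R (f \- g) n.
Proof. by rewrite path_sumB; apply/funext => t /=; rewrite addrC subrK. Qed.

(** The factor 4 comes from two splittings with [t = 1]: the path sum of [f] into those of [b] and
    [f - b], then [b] into [f] and [f - b]. *)
Lemma rvar_path_sum_le n (f : T -> R) : f \in Lfun pi 2%:E ->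
  rvar (mu n) (@path_sum _ T R f n) <= n%:R * (4 * K * rvar pi f).
Proof.
move=> f2; apply/ler_addgt0Pr => e e0.
(* [c] collects the coefficients of the squared distance from [f] to [b] in these estimates. It
   depends on [n], and so may [b]. *)
pose c : R := 4 * K * n%:R + 2 * 4 ^+ n.
have c0 : 0 < c.
  by rewrite ltr_wpDl ?mulr_ge0// mulr_gt0// exprn_gt0.
have [b fb] := bfun_dense f2 (divr_gt0 e0 c0).
have b2 : (b : T -> R) \in Lfun pi 2%:E by exact: Lfun_bmeas (bfunP b).
have g2 := LfunB f2 b2.
have := rvarD_le (Lfun_path_sum n b2) (Lfun_path_sum n g2) ltr01.
rewrite -path_sumK invr1 => h1.
have h2 := rvar_path_sum_sqr n g2 fb.
have := rvarB_le f2 g2 ltr01.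
rewrite (_ : f \- (f \- b) = b); last first.
  by apply/funext => x /=; rewrite opprB addrC subrK.
rewrite invr1 => h3; have h4 := rvar_le_sqr g2 fb.
have h5 := path_sum_le n b.
have -> : e = c * (e / c) by field; rewrite gt_eqF.
move: (e / c) h2 h4 => u h2 h4.
have nK : 0 <= n%:R * K by rewrite mulr_ge0.
have h6 := ler_wpM2l nK h3.
have h7 := ler_wpM2l nK h4.
rewrite /c; move: (4 ^+ n) h2 => q h2.
rewrite (le_trans h1)// ; lra.
Qed.

Hypothesis path_sum_cvg : forall b : bfun R T,
  cvgn (fun n => n%:R^-1 * rvar (mu n) (@path_sum _ T R b n)).

(** [rvar_path_sum_le] applied to [f - b] controls the error uniformly in [n], whence a uniform
    approximation by convergent sequences. *)
Lemma cvgn_rvar_path_sum (f : T -> R) : f \in Lfun pi 2%:E ->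
  cvgn (fun n => n%:R^-1 * rvar (mu n) (@path_sum _ T R f n)).
Proof.
move=> f2; apply: cvgn_unif_approx => e e0.
(* [A] bounds the scaled variances of both [f] and [b]. The two differ by at most [t * A] plus
   [(1 + t^-1) * (4 * K) * u]; [t] is chosen to make the first [e / 2], then [u] to make the second
   at most [e / 2]. *)
pose A := 8 * K * (rvar pi f + 1) + 1.
have v0 := rvar_ge0 pi f.
have A0 : 0 < A by rewrite ltr_wpDl// !mulr_ge0// addr_ge0.
pose t := e / 2 / A.
have t0 : 0 < t by rewrite !divr_gt0.
pose c := (1 + t^-1) * (4 * K) + 1.
have c0 : 0 < c by rewrite ltr_wpDl// !mulr_ge0// addr_ge0// invr_ge0 ltW.
pose u := Num.min 1 (e / 2 / c).
have u0 : 0 < u by rewrite lt_min ltr01 !divr_gt0.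
have u1 : u <= 1 by rewrite ge_min lexx.
have uc : c * u <= e / 2.
  by rewrite -ler_pdivlMl// mulrC ge_min lexx orbT.
have tA : t * A = e / 2 by rewrite /t divfK// gt_eqF.
have [b fb] := bfun_dense f2 u0.
have b2 : (b : T -> R) \in Lfun pi 2%:E by exact: Lfun_bmeas (bfunP b).
have g2 := LfunB f2 b2.
exists (fun n => n%:R^-1 * rvar (mu n) (@path_sum _ T R b n)); split => // n.
have h4 := rvar_le_sqr g2 fb.
have := rvarB_le f2 g2 ltr01.
rewrite (_ : f \- (f \- b) = b); last first.
  by apply/funext => x /=; rewrite opprB addrC subrK.
rewrite invr1 => h3.
have S1 := Lfun_path_sum n f2; have S2 := Lfun_path_sum n b2.
have S3 := Lfun_path_sum n g2.
have l1 := rvarD_le S2 S3 t0; rewrite -path_sumK in l1.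
have l2 := rvarB_le S1 S3 t0.
rewrite (_ : _ \- _ = @path_sum _ T R b n) in l2; last first.
  by rewrite path_sumB; apply/funext => s /=; rewrite opprB addrC subrK.
have [->|n0] := posnP n.
  by rewrite invr0 !mul0r subrr normr0 ltW.
have nn : 0 < n%:R^-1 :> R by rewrite invr_gt0 ltr0n.
have scale (x y : R) : x <= n%:R * y -> n%:R^-1 * x <= y.
  by move=> xy; rewrite ler_pdivrMl// ltr0n.
have k1 := scale _ _ (rvar_path_sum_le n f2).
have k2 := scale _ _ (rvar_path_sum_le n b2).
have k3 := scale _ _ (rvar_path_sum_le n g2).
have m1 := ler_wpM2l (ltW nn) l1; have m2 := ler_wpM2l (ltW nn) l2.
have bA : n%:R^-1 * rvar (mu n) (@path_sum _ T R b n) <= A.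
  apply: (le_trans k2); have := ler_wpM2l K_ge0 h3.
  have := ler_wpM2l K_ge0 (le_trans h4 u1); rewrite /A; lra.
have fA : n%:R^-1 * rvar (mu n) (@path_sum _ T R f n) <= A.
  apply: (le_trans k1); rewrite /A; have := mulr_ge0 K_ge0 v0.
  by have := K_ge0; lra.
have gZ : (1 + t^-1) * (n%:R^-1 * rvar (mu n) (@path_sum _ T R (f \- b) n)) <= e / 2.
  apply: le_trans uc; rewrite /c [leRHS]mulrDl mul1r -[X in _ <= X + _]mulrA.
  rewrite ler_wpDr ?(ltW u0)//.
  apply: ler_wpM2l; first by rewrite addr_ge0// invr_ge0 ltW.
  by rewrite (le_trans k3)// ler_wpM2l// mulr_ge0.
have tb := ler_wpM2l (ltW t0) bA; have tf := ler_wpM2l (ltW t0) fA.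
move: m1 m2 gZ tb tf; rewrite tA !mulrDr !(mulrCA n%:R^-1).
move: (n%:R^-1 * rvar _ _) (n%:R^-1 * rvar _ _) (n%:R^-1 * rvar _ _) => X Y Z.
move: (t^-1) => ti m1 m2 gZ tb tf; rewrite ler_norml; apply/andP; split; lra.
Qed.

End variance_bounding_L2.

(** * Equivalence of variance bounding and the Poincare inequality *)

Lemma Lfun_variance_lty (R : realType) d (T : measurableType d)
    (pi : probability T R) (h : T -> R) :
  measurable_fun [set: T] h -> ('V_pi[h] < +oo)%E -> h \in Lfun pi 2%:E.
Proof.
move=> mh; rewrite /variance unlock; set c := fine _; rewrite unlock => Vh.
(* Finite variance says that [h - c] is square-integrable. This holds whatever [c] is, even the
   default 0 of [fine], and adding a constant back stays in [L^2]. *)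
have hc2 : (h \- cst c) \in Lfun pi 2%:E.
  by apply: Lfun2_sqr => //; exact: measurable_funB.
rewrite (_ : h = (h \- cst c) \+ cst c); last first.
  by apply/funext => x /=; rewrite subrK.
by apply: LfunD => //; exact: Lfun_cst.
Qed.

Lemma scaled_varianceE (R : realType) d (T : measurableType d)
    (P : R.-pker T ~> T) (pi : probability T R) (h : T -> R) :
  stationary P pi -> h \in Lfun pi 2%:E ->
  scaled_variance P pi h =
  fun n => (n%:R^-1 * rvar (path_law P pi n) (@path_sum _ T R h n))%:E.
Proof.
move=> sP h2; apply/funext => n; rewrite EFinM -rvarE//.
exact: Lfun_path_sum.
Qed.

Lemma rvar_path_sum_bfun (R : realType) d (T : measurableType d)
    (P : R.-pker T ~> T) (pi : probability T R) n (b : bfun R T) :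
  stationary P pi -> rvar (path_law P pi n) (@path_sum _ T R b n) =
  path_form (bcov pi) (bfun_op P) n b b.
Proof. by move=> sP; rewrite /rvar variance_path_sum. Qed.

Lemma variance_bounding_poincare (R : realType) d (T : measurableType d)
    (P : R.-pker T ~> T) (pi : probability T R) :
  stationary P pi -> reversible P pi -> variance_bounding P pi ->
  exists2 C : R, 0 < C & forall f : bfun R T,
    bcov pi f f <= C * (bcov pi f f - bcov pi f (bfun_op P f)).
Proof.
(* [variance_bounding] allows a negative [K], while the choice of [a] requires a nonnegative one. *)
move=> sP rP [K vb]; pose K' := Num.max K 0; pose a := (K' + 1) / 4.
have K'0 : 0 <= K' by rewrite le_max lexx orbT.
have a0 : 0 < a by rewrite /a divr_gt0// ltr_wpDl.
exists (2 * a ^+ 2 + 2 * a) => [|f].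
  by apply: addr_gt0; apply: mulr_gt0 => //; exact: exprn_gt0.
have bf := bfunP f.
have f2 : (f : T -> R) \in Lfun pi 2%:E by exact: Lfun_bmeas.
have [||] := vb f; first by case: bf.
  by rewrite variance_bcov ltry.
rewrite /asymptotic_variance scaled_varianceE// variance_bcov.
set u := fun n => _ => cu uK.
have u0 : (0 <= limn u)%E.
  apply: lime_ge => //; apply: nearW => n.
  by rewrite lee_fin mulr_ge0 ?invr_ge0 ?ler0n// rvar_ge0.
have N0 : 0 <= bcov pi f f := le_trans (normr_ge0 _) (bcov_contr sP f).
have uf : limn u \is a fin_num.
  by rewrite ge0_fin_numE// (le_lt_trans uK)// -EFinM ltry.
apply: (@poincare_of_variance_bound R (bfun R T) (bcov pi) (bfun_op P)
  (@bcovC _ _ _ pi) (@bcovDl _ _ _ pi) (@bcovZl _ _ _ pi)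
  (bcov_sym sP rP) (bcov_contr sP) K' a (fine (limn u))) => //.
- by move=> n g; rewrite -rvar_path_sum_bfun// rvar_ge0.
- have /fine_cvgP[_] : u n @[n --> \oo] --> (fine (limn u))%:E by rewrite fineK.
  rewrite (_ : fine \o u = fun n : nat =>
    n%:R^-1 * path_form (bcov pi) (bfun_op P) n f f)//.
  by apply/funext => n /=; rewrite rvar_path_sum_bfun.
- rewrite -lee_fin fineK//; apply: (le_trans uK).
  by rewrite -EFinM lee_fin ler_wpM2r// le_max lexx.
Qed.

Lemma poincare_variance_bounding (R : realType) d (T : measurableType d)
    (P : R.-pker T ~> T) (pi : probability T R) (C : R) :
  stationary P pi -> reversible P pi -> 0 < C ->
  (forall f : bfun R T,
    bcov pi f f <= C * (bcov pi f f - bcov pi f (bfun_op P f))) ->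
  variance_bounding P pi.
Proof.
move=> sP rP C0 poinc.
have K0 : 0 <= 4 * C by rewrite mulr_ge0// ltW.
have bound n (b : bfun R T) : rvar (path_law P pi n) (@path_sum _ T R b n) <=
    n%:R * (4 * C * rvar pi b).
  rewrite rvar_path_sum_bfun// [rvar pi b](_ : _ = bcov pi b b).
    exact: (path_form_le (@bcovC _ _ _ pi) (@bcovDl _ _ _ pi)
      (@bcovZl _ _ _ pi) (bcov_sym sP rP) (bcov_contr sP) C0 poinc).
  by rewrite /rvar variance_bcov.
have conv (b : bfun R T) : cvgn (fun n =>
    n%:R^-1 * rvar (path_law P pi n) (@path_sum _ T R b n)).
  under eq_fun do rewrite rvar_path_sum_bfun//.
  exact: (cvgn_path_form (@bcovC _ _ _ pi) (@bcovDl _ _ _ pi)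
      (@bcovZl _ _ _ pi) (bcov_sym sP rP) (bcov_contr sP) C0 poinc).
(* [4 C] is the constant on bounded functions, and the passage to [L^2] costs another factor 4. *)
exists (4 * (4 * C)) => h mh /(Lfun_variance_lty mh) h2.
have cv := cvgn_rvar_path_sum sP K0 bound conv h2.
rewrite /asymptotic_variance scaled_varianceE//.
have /cvg_ex[/= l ul] := cv.
set u := fun n => _.
have ulE : u n @[n --> \oo] --> l%:E.
  by apply: cvg_EFin => //; exact: nearW.
split; first by apply/cvg_ex; exists l%:E.
rewrite (cvg_lim _ ulE)// rvarE// -EFinM lee_fin -(cvg_lim _ ul)//.
apply: limr_le => //; apply: nearW => n.
have [->|n0] := posnP n; first by rewrite invr0 mul0r !mulr_ge0 ?rvar_ge0 ?ltW.
rewrite ler_pdivrMl ?ltr0n//.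
exact: (rvar_path_sum_le sP K0 bound n h2).
Qed.

Theorem theorem8 (R : realType) (d : measure_display) (T : measurableType d)
    (P1 P2 : probability_kernel T T R) (pi : probability T R)
    (P1_pi : unique_stationary P1 pi) (P2_pi : unique_stationary P2 pi)
    (P1_rev : reversible P1 pi) (P2_rev : reversible P2 pi)
    (P1_dom_P2 : dominates_off_diagonal P1 P2)
    (P2_vb : variance_bounding P2 pi) :
  variance_bounding P1 pi.
Proof.
have [[s1 _] [s2 _]] := (P1_pi, P2_pi).
have [C C0 poinc] := variance_bounding_poincare s2 P2_rev P2_vb.
(* The Poincare constant of [P2] also serves [P1], whose Dirichlet form is at least as large. *)
apply: (poincare_variance_bounding s1 P1_rev C0) => f.
by rewrite (le_trans (poinc f))// ler_wpM2l ?(ltW C0)// bcov_dirichlet_le.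
Qed.
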